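(* Let $a_1,a_2>0$, let $\alpha,\beta\in C^2(\mathbb{R}_+,\mathbb{R}_+)$ satisfy $(M_1)$–$(M_4)$, and let $V_1,V_2,\lambda$ satisfy $(V_1)$, $(V_2)$, $(V_3)$ (all conditions as listed in the context). Assume in addition that, for some constant $C>0$: $(V_4)$ for $i=1,2$, $V_i\in C^1(\mathbb{R}^3)$ and $0\le\langle\nabla V_i(x),x\rangle\le C V_i(x)$ for all $x\in\mathbb{R}^3$; $(V_5)$ $\lambda\in C^1(\mathbb{R}^3)$, $|\langle\nabla\lambda(x),x\rangle|\le C|\lambda(x)|$ and $\langle\nabla\lambda(x),x\rangle\le0$ for all $x\in\mathbb{R}^3$. Then for every $\mu\ge0$ the system $$\begin{cases}\left(a_1+\alpha'(\|u\|_{E_1}^2)\right)(-\Delta u+V_1(x)u)=\mu|u|^{4}u+\lambda(x)v, & x\in\mathbb{R}^3,\\ \left(a_2+\beta'(\|v\|_{E_2}^2)\right)(-\Delta v+V_2(x)v)=|v|^{4}v+\lambda(x)u, & x\in\mathbb{R}^3,\end{cases}$$ (the case $p=q=6$) has no positive classical solution.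
   Context: $\mathbb{R}_+=[0,\infty)$. For $i=1,2$, $E_i=\{w\in H^1(\mathbb{R}^3):\int_{\mathbb{R}^3}V_i(x)w^2\,dx<\infty\}$ with $\|w\|_{E_i}^2=\int_{\mathbb{R}^3}|\nabla w|^2\,dx+\int_{\mathbb{R}^3}V_i(x)w^2\,dx$, and $E=E_1\times E_2$. A positive classical solution is a pair $(u,v)\in E$ of $C^2$ functions satisfying the equations pointwise with $u,v>0$ in $\mathbb{R}^3$. Conditions on $\alpha,\beta$: $(M_1)$ $\alpha'(s)$ and $\beta'(t)$ are increasing on $s,t>0$. $(M_2)$ $s\mapsto\alpha'(s)/s$ and $t\mapsto\beta'(t)/t$ are non-increasing on $s,t>0$. $(M_3)$ For some constants $b_1,b_2>0$: $\alpha'(s)\le b_1 s$, $\beta'(t)\le b_2 t$, and $\frac12\alpha'(s)s+\frac12\beta'(t)t\le\alpha(s)+\beta(t)\le\alpha'(s)s+\beta'(t)t$ for all $s,t\ge0$. $(M_4)$ $\alpha''(s)s\le\alpha'(s)$ and $\beta''(t)t\le\beta'(t)$ for all $s,t\ge0$. Conditions on $V_1,V_2,\lambda$: $(V_1)$ $V_1,V_2,\lambda\in C(\mathbb{R}^3,\mathbb{R})$ are $\mathbb{Z}^3$-periodic. $(V_2)$ For $i=1,2$: $V_i(x)\ge0$ for all $x\in\mathbb{R}^3$ and $\inf\{\|u\|_{E_i}^2: u\in E_i,\ \int_{\mathbb{R}^3}u^2\,dx=1\}>0$. $(V_3)$ There is $\delta\in(0,\min\{a_1,a_2\})$ with $|\lambda(x)|\le\delta\sqrt{V_1(x)V_2(x)}$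 for all $x\in\mathbb{R}^3$. *)

(* Defs.v *)
From HB Require Import structures.
From mathcomp Require Import all_boot all_order all_algebra.
From mathcomp Require Import all_classical all_reals all_analysis.
Set Implicit Arguments.
Unset Strict Implicit.
Unset Printing Implicit Defensive.
Import Order.TTheory GRing.Theory Num.Theory.
Import numFieldNormedType.Exports.
Local Open Scope classical_set_scope.
Local Open Scope ring_scope.

Notation R3 R := (R * R * R)%type.

Section Space.
Context {R : realType}.

Definition coord (i : 'I_3) (x : R3 R) : R :=
  match val i with 0%N => x.1.1 | 1%N => x.1.2 | _ => x.2 end.

Definition std_basis (i : 'I_3) : R3 R :=
  match val i with
  | 0%N => (1, 0, 0) | 1%N => (0, 1, 0) | _ => (0, 0, 1)
  end.

Definition mu3 : {measure set (measurableTypeR R * measurableTypeR R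
                               * measurableTypeR R) -> \bar R} :=
  ((@lebesgue_measure R \x @lebesgue_measure R) \x @lebesgue_measure R)%E.

Definition partial (i : 'I_3) (f : R3 R -> R) : R3 R -> R :=
  'D_(std_basis i) f.

Fixpoint Ck (k : nat) (f : R3 R -> R) : Prop :=
  match k with
  | 0%N => continuous f
  | k'.+1 => [/\ continuous f,
                 forall i x, derivable f x (std_basis i)
               & forall i, Ck k' (partial i f)]
  end.

Definition laplacian (f : R3 R -> R) (x : R3 R) : R :=
  \sum_(i < 3) partial i (partial i f) x.

(* <grad f(x), x> *)
Definition grad_dot_id (f : R3 R -> R) (x : R3 R) : R :=
  \sum_(i < 3) partial i f x * coord i x.

Definition Z3_periodic (f : R3 R -> R) : Prop :=
  forall (k l m : int) (x : R3 R), f (x + (k%:~R, l%:~R, m%:~R)) = f x.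

Definition test_function (phi : R3 R -> R) : Prop :=
  (forall k, Ck k phi) /\ compact (closure [set x | phi x != 0]).

Definition L2 (f : R3 R -> R) : Prop := f \in Lfun mu3 2%:E.

Definition weak_partial (i : 'I_3) (w g : R3 R -> R) : Prop :=
  L2 g /\ forall phi, test_function phi ->
    \int[mu3]_x (w x * partial i phi x) = - \int[mu3]_x (g x * phi x).

(* Elements of the Sobolev space are represented by functions, i.e. without
   taking the quotient by almost-everywhere equality. *)
Definition sobolev_H1 (w : R3 R -> R) : Prop :=
  L2 w /\ forall i, exists g, weak_partial i w g.

(* A chosen representative: the weak derivative is unique up to
   almost-everywhere equality. *)
Definition wpartial (i : 'I_3) (w : R3 R -> R) : R3 R -> R :=
  xget (fun=> 0) [set g | weak_partial i w g].

Definition E_space (V : R3 R -> R) : set (R3 R -> R) :=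
  [set w | sobolev_H1 w /\ (\int[mu3]_x (V x * w x ^+ 2)%:E < +oo)%E].

Definition sqnormE (V w : R3 R -> R) : R :=
  \int[mu3]_x (\sum_(i < 3) wpartial i w x ^+ 2)
  + \int[mu3]_x (V x * w x ^+ 2).

End Space.

Section HalfLine.
Context {R : realType}.

(* Derivative of a function on [0, +oo[: one-sided at 0; values of f at
   negative arguments are irrelevant. *)
Definition quotient_Rplus (f : R -> R) (s : R) : set_system R :=
  (fun h => h^-1 * (f (s + h) - f s)) @ within [set h | 0 <= s + h] 0^'.

Definition derivable_Rplus (f : R -> R) (s : R) : Prop :=
  cvg (quotient_Rplus f s).

Definition derive_Rplus (f : R -> R) (s : R) : R := lim (quotient_Rplus f s).

Definition C2_Rplus (f : R -> R) : Prop :=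
  [/\ forall s, 0 <= s -> 0 <= f s,
      forall s, 0 <= s -> derivable_Rplus f s,
      forall s, 0 <= s -> derivable_Rplus (derive_Rplus f) s
    & {within `[0, +oo[, continuous (derive_Rplus (derive_Rplus f))}].

End HalfLine.

Section Conditions.
Context {R : realType}.
Implicit Types (alpha beta : R -> R) (V lam : R3 R -> R).

Definition cond_M1 alpha beta : Prop :=
  (forall s t, 0 < s -> s < t -> derive_Rplus alpha s < derive_Rplus alpha t)
  /\ (forall s t, 0 < s -> s < t -> derive_Rplus beta s < derive_Rplus beta t).

Definition cond_M2 alpha beta : Prop :=
  (forall s t, 0 < s -> s <= t ->
     derive_Rplus alpha t / t <= derive_Rplus alpha s / s)
  /\ (forall s t, 0 < s -> s <= t ->
        derive_Rplus beta t / t <= derive_Rplus beta s / s).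

Definition cond_M3 alpha beta : Prop :=
  exists b1 b2 : R, [/\ 0 < b1, 0 < b2 &
    forall s t, 0 <= s -> 0 <= t ->
      [/\ derive_Rplus alpha s <= b1 * s,
          derive_Rplus beta t <= b2 * t,
          2^-1 * derive_Rplus alpha s * s + 2^-1 * derive_Rplus beta t * t
            <= alpha s + beta t
        & alpha s + beta t
            <= derive_Rplus alpha s * s + derive_Rplus beta t * t]].

Definition cond_M4 alpha beta : Prop :=
  (forall s, 0 <= s ->
     derive_Rplus (derive_Rplus alpha) s * s <= derive_Rplus alpha s)
  /\ (forall t, 0 <= t ->
        derive_Rplus (derive_Rplus beta) t * t <= derive_Rplus beta t).

Definition cond_V1 V1 V2 lam : Prop :=
  [/\ continuous V1 /\ Z3_periodic V1, continuous V2 /\ Z3_periodic V2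
    & continuous lam /\ Z3_periodic lam].

Definition positive_potential V : Prop :=
  (forall x, 0 <= V x) /\
  (0 < ereal_inf [set (sqnormE V w)%:E
                 | w in E_space V `&` [set w | (\int[mu3]_x (w x ^+ 2))%R = 1%R]])%E.

Definition cond_V2 V1 V2 : Prop := positive_potential V1 /\ positive_potential V2.

Definition cond_V3 (a1 a2 : R) V1 V2 lam : Prop :=
  exists delta : R, [/\ 0 < delta, delta < Num.min a1 a2 &
    forall x, `|lam x| <= delta * Num.sqrt (V1 x * V2 x)].

Definition radially_controlled (C : R) V : Prop :=
  Ck 1 V /\ forall x, 0 <= grad_dot_id V x <= C * V x.

Definition cond_V4 (C : R) V1 V2 : Prop :=
  radially_controlled C V1 /\ radially_controlled C V2.

Definition cond_V5 (C : R) lam : Prop :=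
  Ck 1 lam /\ forall x,
    `|grad_dot_id lam x| <= C * `|lam x| /\ grad_dot_id lam x <= 0.

(* Both equations have the nonlinearity |w|^(p-2) w with p = 6. *)
Definition positive_classical_solution (a1 a2 : R) alpha beta V1 V2 lam (mu : R)
    (u v : R3 R -> R) : Prop :=
  [/\ E_space V1 u /\ E_space V2 v,
      Ck 2 u /\ Ck 2 v,
      forall x, 0 < u x /\ 0 < v x,
      forall x, (a1 + derive_Rplus alpha (sqnormE V1 u))
                  * (- laplacian u x + V1 x * u x)
                = mu * `|u x| ^+ 4 * u x + lam x * v x
    & forall x, (a2 + derive_Rplus beta (sqnormE V2 v))
                  * (- laplacian v x + V2 x * v x)
                = `|v x| ^+ 4 * v x + lam x * u x].

End Conditions.

(* Main.v *)
(* A Z^3-periodic C^1 function [V] with [<grad V(x), x> >= 0] is constant: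
   replacing [x] by [x + k] shows [<grad V(x), x + k> >= 0] for all integer [k],
   so [grad V(x) = 0]. Hence V1 = c1, V2 = c2 and lambda = l are constants with
   [|l| <= delta sqrt(c1 c2)], and the Kirchhoff factors are constants
   A, B > delta, as alpha', beta' >= 0.

   If c1 or c2 is nonzero, the Pohozaev identity applies: the vector field
     F_w = grad w (x.grad w + w/2) - x |grad w|^2 / 2
   has divergence [Delta w (x.grad w + w/2)], so that A F_u + B F_v + x H, with H
   a primitive of the lower-order terms, has divergence
     -(A c1 u^2 + B c2 v^2 - 2 l u v) < 0.
   It is bounded by (1 + |x|) times an integrable function, so its divergence has
   integral 0, a contradiction. Integrability of u^6 and v^6 needs no Sobolev
   embedding: integrate the divergence of w grad w and use the equation.

   If c1 = c2 = 0, then [-B Delta v = v^5]; testing against a dilated cutoff and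
   using v in L^2 gives [int v^5 = 0].

   Solutions are classical, but H^1 only gives weak derivatives in L^2; these
   are identified with the classical ones by testing against smooth functions
   converging to indicators of boxes, which generate the Borel sets. *)

Require Import Defs.
From HB Require Import structures.
From mathcomp Require Import all_boot all_order all_algebra.
From mathcomp Require Import all_classical all_reals all_analysis.
From mathcomp Require Import measurable_realfun ring lra.
(* Needed again: [coord] is also a constant of mathcomp's [vector]. *)
Import Defs.
Set Implicit Arguments.
Unset Strict Implicit.
Unset Printing Implicit Defensive.
Import Order.TTheory GRing.Theory Num.Theory.
Import numFieldNormedType.Exports.
Local Open Scope classical_set_scope.
Local Open Scope ring_scope.

(** The exponent 6 is critical in dimension 3: in the divergence of the combined field, 3 H
    contributes 3/6 of each sixth power and the terms w/2 contribute -1/2 of it, so the powers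
    cancel for every value of mu and only a quadratic form is left. All limits go through cutoffs
    chi(x/n). No plateau is required: chi(x/n) tends everywhere to the constant chi(0) > 0, which
    can be divided out. The gradient of chi(x/n) is O(1/n) and lives where |x| = O(n), hence is
    bounded by M/(1 + |x|); this pays exactly for the factor 1 + |x| of the Pohozaev field, so
    dominated convergence applies with no choice of good radii and no boundary integrals. The
    nonlocal terms enter through the sign of the norms alone. The weak gradient therefore serves a
    single purpose: making the classical |grad u|^2 and |grad v|^2 integrable. Regularity [Ck]
    speaks of coordinate directions only, so differentiation rules, the divergence theorem and the
    symmetry of the Hessian are all obtained by restricting to lines parallel to the axes. *)

Notation mR3 R := (measurableTypeR R * measurableTypeR R * measurableTypeR R)%type.

(** * Measure and integration on R^3 *)

Section Measurability.
Context {R : realType}.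

(** Balls of the product are cubes, hence products of intervals. Those with rational centre and
    radius 1/(n+1) that lie in [O] form a countable cover of it; a radius below half the distance to
    the complement lets the rational centre be moved off the given point. *)
Lemma open_measurable_R3 (O : set (R3 R)) : open O -> measurable (O : set (mR3 R)).
Proof.
move=> oO.
pose c (i : rat * rat * rat) : R3 R := (ratr i.1.1, ratr i.1.2, ratr i.2).
pose F (i : rat * rat * rat * nat) : set (mR3 R) :=
  [set x | ball (c i.1) (i.2.+1%:R^-1) x /\ ball (c i.1) (i.2.+1%:R^-1) `<=` O].
have -> : O = \bigcup_i F i.
  apply/seteqP; split => [x Ox|x [i _ [/= Bx sub]]]; last exact: sub.
  have /nbhs_ballP[e /= e0 xeO] : nbhs x O by exact: open_nbhs_nbhs.
  have [n n1] : exists n : nat, 2 * n.+1%:R^-1 < e.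
    exists (Num.truncn (2 / e)); rewrite ltr_pdivrMr// mulrC -ltr_pdivrMr//.
    by have /andP[] := truncn_itv (ltW (divr_gt0 (ltr0n R 2) e0)).
  set r : R := n.+1%:R^-1 in n1.
  have r0 : 0 < r by rewrite invr_gt0.
  have H (a : R) : exists q : rat, ball (ratr q : R) r a.
    have /rat_in_itvoo[q] : a - r < a + r by lra.
    rewrite in_itv/= => /andP[h1 h2]; exists q.
    by rewrite -ball_normE /ball_ /= ltr_norml; apply/andP; split; lra.
  have [q1 h1] := H x.1.1; have [q2 h2] := H x.1.2; have [q3 h3] := H x.2.
  exists (q1, q2, q3, n) => //; split; first by split; [split|].
  move=> y yb; apply: xeO; apply: le_ball (ltW n1) _ _.
  rewrite mulr_natl mulr2n; apply: (@ball_triangle _ _ (c (q1, q2, q3))) => //.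
  by apply: ball_sym; split; [split|].
apply: countable_bigcupT_measurable; first exact: countableP.
move=> [[[q1 q2] q3] n]; rewrite /F /=.
have [sub|nsub] := pselect (ball (c (q1, q2, q3)) (n.+1%:R^-1) `<=` O); last first.
  by rewrite (_ : [set x | _] = set0)//; apply/seteqP; split => // x [].
rewrite (_ : [set x | _] = (ball (ratr q1 : R) n.+1%:R^-1 `*` ball (ratr q2 : R) n.+1%:R^-1)
    `*` ball (ratr q3 : R) n.+1%:R^-1).
  apply: measurableX; last exact: measurable_ball.
  by apply: measurableX; exact: measurable_ball.
by apply/seteqP; split => [x [[[]]]|x [[]]].
Qed.

Lemma continuous_measurable_R3 (f : R3 R -> R) : continuous f ->
  measurable_fun [set: mR3 R] (f : mR3 R -> measurableTypeR R).
Proof.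
move=> cf; apply: (measurability _ (RGenOInfty.measurableE R)).
move=> _ [_ [a ->] <-]; rewrite setTI; apply: open_measurable_R3.
by move/continuousP : cf; apply; exact: interval_open.
Qed.

End Measurability.

(* The canonical sigma-finite structure on [\x] is only available for pairs of
   subprobabilities, hence this alias. *)
Section sigma_finite_product.
Context d1 d2 (T1 : measurableType d1) (T2 : measurableType d2) (R : realType).
Variables (m1 : {sigma_finite_measure set T1 -> \bar R})
  (m2 : {sigma_finite_measure set T2 -> \bar R}).

Definition sigma_product : set (T1 * T2) -> \bar R := (m1 \x m2)%E.

HB.instance Definition _ := Measure.on sigma_product.

Lemma sigma_product_sigma_finite : sigma_finite setT sigma_product.
Proof.
have /sigma_finiteP[F [TF ndF Foo]] := sigma_finiteT m1.
have /sigma_finiteP[G [TG ndG Goo]] := sigma_finiteT m2.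
exists (fun n => F n `*` G n).
  rewrite -setXTT TF TG; apply/seteqP; split => [[x y]|[x y] [n _ []/= ? ?]]; last first.
    by split; exists n.
  move=> [/= [n _ Fnx] [k _ Gky]]; exists (maxn n k) => //; split.
  - by move: x Fnx; exact/subsetPset/ndF/leq_maxl.
  - by move: y Gky; exact/subsetPset/ndG/leq_maxr.
move=> k; have [? ?] := Foo k; have [? ?] := Goo k.
split; first exact: measurableX.
by rewrite /sigma_product product_measure1E// lte_mul_pinfty// ge0_fin_numE.
Qed.

HB.instance Definition _ := Measure_isSigmaFinite.Build _ _ _ sigma_product
  sigma_product_sigma_finite.

End sigma_finite_product.

Section Line.
Context {R : realType} {V : normedModType R}.

(** This transports one-variable calculus (chain rule, mean value theorem, fundamental theorem) to
    directional derivatives: the two difference quotients are the same function. *)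
Lemma is_derive_line (f : V -> R) (x v : V) (t : R) :
  derivable f (t *: v + x) v ->
  is_derive t (1 : R) (fun s : R => f (s *: v + x)) ('D_v f (t *: v + x)).
Proof.
move=> df; rewrite /derive.
have E : (fun h : R => h^-1 *: (f ((h *: (1 : R) + t) *: v + x) - f (t *: v + x)))
   = (fun h : R => h^-1 *: (f (h *: v + (t *: v + x)) - f (t *: v + x))).
  apply/funext => h; rewrite [h *: 1](_ : _ = h); last by rewrite /GRing.scale/= mulr1.
  by rewrite scalerDl addrA.
apply: DeriveDef; first by rewrite /derivable E.
by rewrite /derive E.
Qed.

End Line.

Section Integration.
Context {R : realType}.
Implicit Types f F : R3 R -> R.

Lemma bounded_support_integrable d (T : measurableType d)
    (mu : {measure set T -> \bar R}) (A : set T) (M : R) (f : T -> R) :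
  measurable_fun setT f -> measurable A -> (mu A < +oo)%E ->
  (forall x, `|f x| <= M) -> (forall x, ~ A x -> f x = 0) ->
  mu.-integrable setT (EFin \o f).
Proof.
move=> mf mA Aoo fM f0.
have -> : EFin \o f = (EFin \o f) \_ A.
  apply/funext => x; rewrite patchE; case: ifPn => // /negP xA /=.
  by rewrite f0// => Ax; apply: xA; rewrite inE.
apply/(integrable_mkcond _ mA); apply: measurable_bounded_integrable => //.
  exact: measurable_funS mf.
exists M; split; first exact: num_real.
by move=> y My x _ /=; rewrite (le_trans (fM x))// ltW.
Qed.

Definition box (r : R) : set (mR3 R) :=
  (`[- r, r] `*` `[- r, r]) `*` `[- r, r].

(** One large coordinate suffices for vanishing, which is the form used on lines parallel to an
    axis. The strict inequality makes the vanishing region open. *)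
Definition supported (r : R) (f : R3 R -> R) :=
  forall x i, r < `|coord i x| -> f x = 0.

Lemma measurable_box r : measurable (box r).
Proof. by apply: measurableX => //; exact: measurableX. Qed.

Lemma mu3_box r : 0 <= r -> (mu3 (box r) = ((2 * r) ^+ 3)%:E)%E.
Proof.
move=> r0.
have H : lebesgue_measure `[- r, r]%classic = (2 * r)%:E.
  rewrite lebesgue_measure_itv /= lte_fin.
  have [rr|] := ltP (- r) r; first by rewrite -EFinD; congr EFin; lra.
  by move=> h; congr EFin; lra.
transitivity (((@lebesgue_measure R \x @lebesgue_measure R) \x @lebesgue_measure R)%E (box r)) => //.
rewrite product_measure1E//=; last exact: measurableX.
rewrite product_measure1E//= !H -!EFinM; congr EFin; ring.
Qed.

Lemma box_coord r (x : R3 R) : box r x <-> forall i, `|coord i x| <= r.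
Proof.
split=> [[[/= h0 h1] h2] i|h].
  move: h0 h1 h2; rewrite !in_itv/= -!ler_norml /coord.
  by case: i => [[|[|[|]]]].
have h0 := h (@Ordinal 3 0 isT); have h1 := h (@Ordinal 3 1 isT).
have h2 := h (@Ordinal 3 2 isT).
by split; [split|]; rewrite /= in_itv/= -ler_norml.
Qed.

Lemma supported_box r f x : supported r f -> ~ box r x -> f x = 0.
Proof.
move=> sf bx; have /existsNP[i /negP] : ~ forall i, `|coord i x| <= r.
  by move=> h; apply: bx; apply/box_coord.
by rewrite -ltNge => /sf.
Qed.

Lemma compact_box r : compact (box r : set (R3 R)).
Proof.
by apply: compact_setX; [apply: compact_setX|]; exact: segment_compact.
Qed.

Lemma continuous_box_bounded r f : continuous f ->
  exists M, forall x, box r x -> `|f x| <= M.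
Proof.
move=> cf.
have /compact_bounded[M [_ HM]] : compact (f @` (box r : set (R3 R))).
  apply: continuous_compact; last exact: compact_box.
  exact: continuous_subspaceT.
exists (M + 1) => x bx; apply: HM; first by rewrite ltrDl.
by exists x.
Qed.

Lemma continuous_supported_bounded r f : continuous f -> supported r f ->
  exists M, forall x, `|f x| <= M.
Proof.
move=> cf sf; have [M HM] := continuous_box_bounded r cf.
exists `|M| => x; have [bx|bx] := pselect (box r x).
  by rewrite (le_trans (HM x bx))// ler_norm.
by rewrite (supported_box sf bx) normr0.
Qed.

Lemma supported_integrable r f : continuous f -> supported r f ->
  mu3.-integrable setT (EFin \o f).
Proof.
move=> cf sf; have [M HM] := continuous_supported_bounded cf sf.
(* [r] may be negative, whereas the volume formula asks for a nonnegative size. *)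
apply: (@bounded_support_integrable _ _ _ (box `|r|) M) => //.
- exact: continuous_measurable_R3.
- exact: measurable_box.
- by rewrite mu3_box// ltry.
- move=> x; apply: supported_box => y i h; apply: (sf y i).
  by rewrite (le_lt_trans _ h)// ler_norm.
Qed.

Lemma integral_derive_support (r : R) (F F' : R -> R) :
  (forall x, is_derive x (1 : R) F (F' x)) -> continuous F' ->
  (forall x, r < `|x| -> F x = 0) -> (forall x, r < `|x| -> F' x = 0) ->
  (\int[lebesgue_measure]_x (F' x)%:E = 0)%E.
Proof.
(* [s] is positive and strictly beyond [r], so [F] vanishes at both ends of [-s, s]. *)
move=> dF cF' F0 F'0; pose s := `|r| + 1.
have rs : r < s by rewrite /s (le_lt_trans (ler_norm r))// ltrDl.
have s0 : 0 < s by rewrite /s ltr_wpDl.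
have cF : continuous F.
  by move=> x; apply/differentiable_continuous/derivable1_diffP; have [] := dF x.
pose D : set R := [set` `[- s, s]].
have -> : (\int[lebesgue_measure]_x (F' x)%:E =
    \int[lebesgue_measure]_(x in D) (F' x)%:E)%E.
  rewrite [RHS]integral_mkcond; apply: eq_integral => x _.
  rewrite patchE; case: ifPn => // /negP xs; rewrite F'0//.
  rewrite (lt_trans rs)// ltNge; apply/negP => xs'; apply: xs.
  by rewrite inE/D/= in_itv/= -ler_norml.
rewrite (@continuous_FTC2 _ _ F).
- by rewrite !F0 ?normrN ?subee// ?(gtr0_norm s0).
- by rewrite (lt_trans _ s0)// oppr_lt0.
- exact: continuous_subspaceT.
- split; first by move=> x _; have [] := dF x.
  + exact/cvg_at_right_filter/cF.
  + exact/cvg_at_left_filter/cF.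
- by move=> x _; rewrite derive1E; have [] := dF x.
Qed.

Lemma continuous_coord i : continuous (coord i : R3 R -> R).
Proof.
have cfst (U V : topologicalType) : continuous (fst : U * V -> U).
  by move=> x; exact: cvg_fst.
have csnd (U V : topologicalType) : continuous (snd : U * V -> V).
  by move=> x; exact: cvg_snd.
move=> x; rewrite /coord; case: (val i) => [|[|_]] /=.
- exact: (@continuous_comp _ _ _ fst fst x (cfst _ _ _) (cfst _ _ _)).
- exact: (@continuous_comp _ _ _ fst snd x (cfst _ _ _) (csnd _ _ _)).
- exact: csnd.
Qed.

(** The condition r < |x_j| is open, so [f] is zero near such a point, not only at it. *)
Lemma supported_partial r f i : supported r f -> supported r (partial i f).
Proof.
move=> sf x j rx; rewrite /partial.
rewrite (near_eq_derive (g := cst 0)); first by rewrite derive_cst.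
have cc : continuous (fun y : R3 R => `|coord j y|).
  by move=> y; apply: cvg_norm; exact: continuous_coord.
have : \forall y \near x, r < `|coord j y|.
  exact: (cvgr_gt (`|coord j x|) (cc x) r rx).
by apply: filterS => y /sf.
Qed.

Lemma lineE (t : R) (v x : R3 R) : t *: v + x =
  (t * v.1.1 + x.1.1, t * v.1.2 + x.1.2, t * v.2 + x.2).
Proof. by []. Qed.

Lemma continuous_line (x v : R3 R) : continuous (fun t : R => t *: v + x).
Proof.
by move=> t; apply: cvgD; [apply: cvgZr_tmp; exact: cvg_id|exact: cvg_cst].
Qed.

(** Normalizing the base point by [coord i x = 0] makes the parameter [t] the i-th coordinate
    itself. *)
Lemma integral_line_partial r F i x : coord i x = 0 -> supported r F ->
  (forall y, derivable F y (std_basis i)) -> continuous (partial i F) ->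
  (\int[lebesgue_measure]_t (partial i F (t *: std_basis i + x))%:E = 0)%E.
Proof.
move=> xi0 sF dF cF.
have cx t : coord i (t *: std_basis i + x) = t.
  move: xi0; rewrite /coord /std_basis; case: (val i) => [|[|_]] /= ->;
    by rewrite addr0 [LHS]mulr1.
apply: (@integral_derive_support r (fun t => F (t *: std_basis i + x))).
- by move=> t; exact: is_derive_line.
- move=> t; apply: (@continuous_comp _ _ _ (fun t : R => t *: std_basis i + x)).
    exact: continuous_line.
  exact: cF.
- by move=> t rt; apply: (sF _ i); rewrite cx.
- by move=> t rt; apply: (@supported_partial r F i sF _ i); rewrite cx.
Qed.

Lemma integral_prod0l d1 d2 (T1 : measurableType d1) (T2 : measurableType d2)
    (m1 : {sigma_finite_measure set T1 -> \bar R})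
    (m2 : {sigma_finite_measure set T2 -> \bar R}) (f : T1 * T2 -> \bar R) :
  (sigma_product m1 m2).-integrable setT f -> (forall x, \int[m2]_y f (x, y) = 0)%E ->
  (\int[sigma_product m1 m2]_z f z = 0)%E.
Proof.
by move=> fi f0; rewrite -integral12_prod_meas1//; apply: integral0_eq => x _; exact: f0.
Qed.

Lemma integral_prod0r d1 d2 (T1 : measurableType d1) (T2 : measurableType d2)
    (m1 : {sigma_finite_measure set T1 -> \bar R})
    (m2 : {sigma_finite_measure set T2 -> \bar R}) (f : T1 * T2 -> \bar R) :
  (sigma_product m1 m2).-integrable setT f -> (forall y, \int[m1]_x f (x, y) = 0)%E ->
  (\int[sigma_product m1 m2]_z f z = 0)%E.
Proof.
by move=> fi f0; rewrite -integral21_prod_meas1//; apply: integral0_eq => x _; exact: f0.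
Qed.

Lemma integral_prod3_0l d (T : measurableType d)
    (m : {sigma_finite_measure set T -> \bar R}) (f : T * T * T -> \bar R) :
  (sigma_product (sigma_product m m) m).-integrable setT f ->
  (forall z, \int[m]_t f (z, t) = 0)%E ->
  (\int[sigma_product (sigma_product m m) m]_z f z = 0)%E.
Proof. by move=> fi f0; exact: (integral_prod0l fi f0). Qed.

(** Fubini is applied a second time inside each slice. It would provide integrability of almost
    every slice, and the argument asks for every one, hence the separate hypothesis. *)
Lemma integral_prod3_0m d (T : measurableType d)
    (m : {sigma_finite_measure set T -> \bar R}) (f : T * T * T -> \bar R) :
  (sigma_product (sigma_product m m) m).-integrable setT f ->
  (forall y, (sigma_product m m).-integrable setT (fun z => f (z, y))) ->
  (forall x y, \int[m]_t f (x, t, y) = 0)%E ->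
  (\int[sigma_product (sigma_product m m) m]_z f z = 0)%E.
Proof.
move=> fi fyi f0; apply: (integral_prod0r fi) => y.
by apply: (integral_prod0l (fyi y)) => x.
Qed.

Lemma integral_prod3_0r d (T : measurableType d)
    (m : {sigma_finite_measure set T -> \bar R}) (f : T * T * T -> \bar R) :
  (sigma_product (sigma_product m m) m).-integrable setT f ->
  (forall y, (sigma_product m m).-integrable setT (fun z => f (z, y))) ->
  (forall x y, \int[m]_t f (t, x, y) = 0)%E ->
  (\int[sigma_product (sigma_product m m) m]_z f z = 0)%E.
Proof.
move=> fi fyi f0; apply: (integral_prod0r fi) => y.
by apply: (integral_prod0r (fyi y)) => x.
Qed.

(** Integrating along direction [i] first gives 0 on every line by the fundamental theorem; Fubini
    does the rest, with one case for each position of the variable in the nested product. *)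
Lemma integral_partial r F i : supported r F ->
  (forall x, derivable F x (std_basis i)) -> continuous (partial i F) ->
  (\int[mu3]_x (partial i F x)%:E = 0)%E.
Proof.
move=> sF dF cF.
have sF' : supported r (partial i F) by exact: supported_partial.
pose l1 : {sigma_finite_measure set (measurableTypeR R) -> \bar R} := @lebesgue_measure R.
have intF : (sigma_product (sigma_product l1 l1) l1).-integrable setT (EFin \o partial i F).
  exact: (supported_integrable cF sF').
have mF := continuous_measurable_R3 cF.
have [M HM] := continuous_supported_bounded cF sF'.
have int2 y : (sigma_product l1 l1).-integrable setT
    (EFin \o (fun z : measurableTypeR R * measurableTypeR R => partial i F (z, y))).
  pose I : set (measurableTypeR R) := [set` `[- `|r|, `|r|]].
  pose A := I `*` I.
  apply: (bounded_support_integrable (A := A) (M := M)) => //.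
  - exact: measurable_fun_pair1 mF.
  - by apply: measurableX; exact: measurable_itv.
  - suff : ((l1 \x l1)%E A < +oo)%E by [].
    have lI : (@lebesgue_measure R I = (2 * `|r|)%:E)%E.
      rewrite lebesgue_measure_itv /= lte_fin.
      have := normr_ge0 r; have [_ _|] := ltP; first by rewrite -EFinD; congr EFin; lra.
      by move=> *; congr EFin; lra.
    by rewrite product_measure1E ?[X in (X * X)%E]lI -?EFinM ?ltry//; exact: measurable_itv.
  - move=> z nz; have [//|h] := pselect (partial i F (z, y) = 0).
    exfalso; apply: nz; have H j : `|coord j (z, y)| <= `|r|.
      rewrite leNgt; apply/negP => rj; apply: h; apply: (sF' _ j).
      by rewrite (le_lt_trans _ rj)// ler_norm.
    have := H (@Ordinal 3 0 isT); have := H (@Ordinal 3 1 isT).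
    by rewrite /coord/= !ler_norml => h1 h0; split; rewrite /I /= in_itv.
case: i => [[|[|[|//]]] Hi] in dF cF intF sF' mF HM int2 *.
- apply: (integral_prod3_0r intF int2) => x y.
  apply: etrans (@integral_line_partial r F (Ordinal Hi) ((0, x), y) erefl sF dF cF).
  apply: eq_integral => t _; congr (EFin (partial _ F _)).
  by rewrite lineE/= !(mulr0, mulr1, add0r, addr0).
- apply: (integral_prod3_0m intF int2) => x y.
  apply: etrans (@integral_line_partial r F (Ordinal Hi) ((x, 0), y) erefl sF dF cF).
  apply: eq_integral => t _; congr (EFin (partial _ F _)).
  by rewrite lineE/= !(mulr0, mulr1, add0r, addr0).
- apply: (integral_prod3_0l intF) => -[x1 x2].
  apply: etrans (@integral_line_partial r F (Ordinal Hi) ((x1, x2), 0) erefl sF dF cF).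
  apply: eq_integral => t _; congr (EFin (partial _ F _)).
  by rewrite lineE/= !(mulr0, mulr1, add0r, addr0).
Qed.

End Integration.

(** * Smooth bump functions *)

Section ExpInv.
Context {R : realType}.
Implicit Types p : {poly R}.

(** The extra power [z ^+ n] carries the induction on [p]: the factor 'X of [p * 'X + c] is moved
    into it, and the constant is handled by z^n <= n! exp z. *)
Lemma horner_le_expR p n : exists2 C : R, 0 <= C &
  forall z, 0 <= z -> `|p.[z] * z ^+ n| <= C * expR z.
Proof.
elim/poly_ind: p n => [|p c IH] n.
  by exists 0 => // z z0; rewrite horner0 mul0r normr0 mul0r.
have [C C0 HC] := IH n.+1; exists (C + `|c| * n`!%:R).
  by rewrite addr_ge0// mulr_ge0.
move=> z z0; rewrite hornerMXaddC mulrDl -mulrA -exprS mulrDl.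
rewrite (le_trans (ler_normD _ _))// lerD//; first exact: HC.
rewrite normrM (ger0_norm (exprn_ge0 n z0)) -mulrA ler_wpM2l//.
case: n HC => [|n] _; first by rewrite expr0 fact0 mul1r -expR0 ler_expR.
rewrite mulrC -ler_pdivrMr ?ltr0n ?fact_gt0//.
by rewrite (le_trans _ (expR_ge1Dxn n z0))// lerDr.
Qed.

(* The functions [p(1/y) exp(-1/y)], extended by [0] to [y <= 0]; the family is
   stable under differentiation. *)
Definition exp_inv p (y : R) : R :=
  if 0 < y then p.[y^-1] * expR (- y^-1) else 0.

(** With z = 1/y, the derivative in y of p(z) exp(-z) is z^2 (p(z) - p'(z)) exp(-z). *)
Definition exp_inv_deriv p : {poly R} := 'X^2 * (p - p^`()).

(** A quadratic bound makes the difference quotient at 0 of order |y|, so the derivative there is 0.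
    In terms of z = 1/y it reads |p(z)| z^2 <= C exp z. *)
Lemma exp_inv_bound p : exists2 C : R, 0 <= C &
  forall y, `|exp_inv p y| <= C * `|y| ^+ 2.
Proof.
have [C C0 HC] := horner_le_expR p 2; exists C => // y.
rewrite /exp_inv; case: ltP => [y0|_]; last first.
  by rewrite normr0 mulr_ge0// exprn_ge0.
have yi0 : 0 <= y^-1 by rewrite invr_ge0 ltW.
rewrite (gtr0_norm y0) normrM.
have := HC _ yi0; rewrite normrM (ger0_norm (exprn_ge0 2 yi0)) exprVn ler_pdivrMr ?exprn_gt0// => H.
rewrite (gtr0_norm (expR_gt0 _)) expRN ler_pdivrMr ?expR_gt0//.
by rewrite mulrAC.
Qed.

Lemma is_derive_exp_inv p (y : R) :
  is_derive y (1 : R) (exp_inv p) (exp_inv (exp_inv_deriv p) y).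
Proof.
have [y0|y0|->] := ltrgtP y 0.
- rewrite /exp_inv ltNge (ltW y0)/=.
  apply: (near_eq_is_derive (f := cst 0)).
  have : \forall z \near y, z < 0 by exact: lt_nbhsl.
  by apply: filterS => z z0; rewrite ltNge (ltW z0).
- rewrite {2}/exp_inv y0.
  have yn0 : id y != 0 by rewrite gt_eqF.
  have dV : is_derive y (1 : R) (fun z : R => z^-1) (- y ^- 2).
    apply: DeriveDef; first by apply: (derivableV (f := id) yn0); exact: derivable_id.
    rewrite (deriveV (f := id) yn0); last exact: derivable_id.
    by rewrite derive_id [LHS]mulr1.
  have dp : is_derive (y^-1) (1 : R) (horner p) (p^`()).[y^-1].
    by rewrite derivE derive1E; apply: derivableP; exact: derivable_horner.
  have d1 := is_derive1_comp dp dV.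
  have dN : is_derive (- y^-1) (1 : R) expR (expR (- y^-1)).
    exact: is_derive_expR.
  have dV' : is_derive y (1 : R) (fun z : R => - z^-1) (y ^- 2).
    by apply: is_derive_eq; rewrite opprK.
  have d2 := @is_derive1_comp R expR (fun z => - z^-1) _ _ _ dN dV'.
  pose F (z : R) := p.[z^-1] * expR (- z^-1).
  have d3 : is_derive y (1 : R) F _ := is_deriveM d1 d2.
  have nE : \forall z \near y, F z = exp_inv p z.
    have : \forall z \near y, 0 < z by exact: lt_nbhsr.
    by apply: filterS => z z0; rewrite /exp_inv z0.
  have d4 := near_eq_is_derive nE d3.
  apply: (is_derive_eq d4).
  rewrite /exp_inv_deriv hornerM hornerXn hornerD hornerN /GRing.scale/= exprVn.
  ring.
- have -> : exp_inv (exp_inv_deriv p) 0 = 0 by rewrite /exp_inv ltxx.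
  have [C C0 HC] := exp_inv_bound p.
  have : (fun h : R => h^-1 *: (exp_inv p (h *: 1 + 0) - exp_inv p 0)) @ 0^' --> (0 : R).
    apply/cvgr0Pnorm_le => e e0.
    (* The divisor is [C + 1] because [C] may be 0. *)
    have Ce : 0 < e / (C + 1) by rewrite divr_gt0// ltr_wpDl.
    near=> h.
    have h0 : h != 0 by near: h; exact: nbhs_dnbhs_neq.
    have -> : exp_inv p 0 = 0 by rewrite /exp_inv ltxx.
    rewrite subr0 addr0 [h *: 1](_ : _ = h); last exact: mulr1.
    rewrite normrZ normfV ler_pdivrMl ?normr_gt0//.
    rewrite (le_trans (HC h))// expr2 mulrA mulrC ler_wpM2l//.
    have hC : `|h| <= e / (C + 1).
      by near: h; exact: (@dnbhs0_le _ R^o _ Ce).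
    rewrite (le_trans (ler_wpM2l C0 hC))// mulrCA ler_piMr ?ltW//.
    by rewrite ltr_pdivrMr ?mul1r ?ltrDl// ltr_wpDl.
  move=> H; apply: DeriveDef; first by apply/cvg_ex; exists 0.
  exact: cvg_lim H.
Unshelve. all: by end_near.
Qed.

End ExpInv.

(** * Directional derivatives and C^k calculus *)

Section DirectionalCalculus.
Context {R : realType} {V : normedModType R}.
Implicit Types f g : V -> R.

Lemma is_derive_of_line f (x v : V) (d : R) :
  is_derive (0 : R) (1 : R) (fun s : R => f (s *: v + x)) d ->
  is_derive x v f d.
Proof.
move=> [df <-].
have E : (fun h : R => h^-1 *: (f ((h *: (1 : R) + 0) *: v + x) - f ((0 : R) *: v + x)))
   = (fun h : R => h^-1 *: (f (h *: v + x) - f x)).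
  apply/funext => h; rewrite [h *: 1](_ : _ = h); last exact: mulr1.
  by rewrite addr0 scale0r add0r.
move: df; rewrite /derivable /= E => df; apply: DeriveDef; first exact: df.
by rewrite /derive /= E.
Qed.

(** Only one directional derivative of [f] is given, not differentiability, so the rule is proved on
    the line through [x] in direction [v], where it is the one-variable chain rule. *)
Lemma is_derive_chain (g : R -> R) f (x v : V) (a b : R) :
  is_derive (f x) (1 : R) g a -> is_derive x v f b ->
  is_derive x v (fun y => g (f y)) (a * b).
Proof.
move=> dg [df <-]; apply: is_derive_of_line.
have E : (0 : R) *: v + x = x by rewrite scale0r add0r.
have dl : is_derive (0 : R) (1 : R) (fun s : R => f (s *: v + x)) ('D_v f x).
  by rewrite -[in 'D_v f x]E; apply: is_derive_line; rewrite E.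
by apply: (is_derive1_comp _ dl); rewrite E.
Qed.

Lemma is_derive_add f g (x v : V) (a b : R) :
  is_derive x v f a -> is_derive x v g b ->
  is_derive x v (fun y => f y + g y) (a + b).
Proof. by move=> df dg; exact: is_deriveD. Qed.

Lemma is_derive_sub f g (x v : V) (a b : R) :
  is_derive x v f a -> is_derive x v g b ->
  is_derive x v (fun y => f y - g y) (a - b).
Proof. by move=> df dg; exact: is_deriveB. Qed.

Lemma is_derive_mul f g (x v : V) (a b : R) :
  is_derive x v f a -> is_derive x v g b ->
  is_derive x v (fun y => f y * g y) (a * g x + f x * b).
Proof.
move=> df dg.
apply: (@is_derive_eq _ _ _ (fun y => f y * g y) x v _ _ (is_deriveM df dg)).
by rewrite /GRing.scale/=; ring.
Qed.

Lemma is_derive_scale (c : R) f (x v : V) (a : R) :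
  is_derive x v f a -> is_derive x v (fun y => c * f y) (c * a).
Proof. by move=> df; have := @is_deriveZ _ _ _ f c x v a df. Qed.

Lemma is_derive_pow n f (x v : V) (a : R) :
  is_derive x v f a ->
  is_derive x v (fun y => f y ^+ n.+1) (n.+1%:R * f x ^+ n * a).
Proof.
move=> df; elim: n => [|n IH].
  by rewrite expr0 !mul1r.
have H := is_derive_mul df IH.
have -> : (fun y => f y ^+ n.+2) = (fun y => f y * f y ^+ n.+1).
  by apply/funext => y; rewrite exprS.
by apply: (is_derive_eq H); rewrite -[n.+2%:R]natr1 exprS; ring.
Qed.

Lemma is_derive_derivable f (x v : V) a : is_derive x v f a -> derivable f x v.
Proof. by case. Qed.

End DirectionalCalculus.

Section Smooth.
Context {R : realType}.
Implicit Types f g : R3 R -> R.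

Lemma is_derive_coord i j (x : R3 R) :
  is_derive x (std_basis i) (coord j) ((i == j)%:R : R).
Proof.
apply: is_derive_of_line.
have -> : (fun s : R => coord j (s *: std_basis i + x)) = (fun s => (i == j)%:R * s + coord j x).
  apply/funext => s; rewrite lineE.
  by case: i => [[|[|[|//]]] Hi]; case: j => [[|[|[|//]]] Hj];
    rewrite /coord/= ?mulr1 ?mulr0 ?mul0r ?mul1r.
have H : is_derive (0 : R) (1 : R) (fun s => (i == j)%:R * s + coord j x) _ :=
  is_derive_add (is_derive_scale (i == j)%:R (is_derive_id (0 : R) (1 : R)))
  (is_derive_cst (coord j x) (0 : R) (1 : R)).
by apply: (is_derive_eq H); rewrite mulr1 addr0.
Qed.

Lemma partial_eq i f x d : is_derive x (std_basis i) f d -> partial i f x = d.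
Proof. by case. Qed.

Lemma Ck_continuous k f : Ck k f -> continuous f.
Proof. by case: k => [//|k] []. Qed.

Lemma Ck_pred k f : Ck k.+1 f -> Ck k f.
Proof.
elim: k f => [|k IH] f; first by case.
by move=> [cf df Cf]; split => // i; exact: IH.
Qed.

Lemma Ck_derive k f i x : Ck k.+1 f ->
  is_derive x (std_basis i) f (partial i f x).
Proof. by move=> [_ df _]; exact: derivableP. Qed.

Lemma Ck_partial k f i : Ck k.+1 f -> Ck k (partial i f).
Proof. by move=> [_ _ Cf]; exact: (Cf i). Qed.

(** Explicit formulas [df] for the partial derivatives replace [partial i f], which turns each
    regularity proof into an induction on [k]. *)
Lemma CkS k f (df : 'I_3 -> R3 R -> R) : continuous f ->
  (forall i x, is_derive x (std_basis i) f (df i x)) ->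
  (forall i, Ck k (df i)) -> Ck k.+1 f.
Proof.
move=> cf dfE Cdf; split; [exact: cf|move=> i x|move=> i]; first exact: is_derive_derivable (dfE i x).
suff -> : partial i f = df i by exact: (Cdf i).
by apply/funext => x; exact: (partial_eq (dfE i x)).
Qed.

Lemma Ck_add k f g : Ck k f -> Ck k g -> Ck k (fun x => f x + g x).
Proof.
elim: k f g => [|k IH] f g Cf Cg.
  by move=> x; apply: cvgD; [exact: (Cf x)|exact: (Cg x)].
have D i x := is_derive_add (Ck_derive i x Cf) (Ck_derive i x Cg).
apply: (CkS _ D) => [x|i].
  by apply: cvgD; [exact: (Ck_continuous Cf)|exact: (Ck_continuous Cg)].
exact: IH (Ck_partial i Cf) (Ck_partial i Cg).
Qed.

Lemma Ck_mul k f g : Ck k f -> Ck k g -> Ck k (fun x => f x * g x).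
Proof.
elim: k f g => [|k IH] f g Cf Cg.
  by move=> x; apply: cvgM; [exact: (Cf x)|exact: (Cg x)].
have D i x := is_derive_mul (Ck_derive i x Cf) (Ck_derive i x Cg).
apply: (CkS _ D) => [x|i].
  by apply: cvgM; [exact: (Ck_continuous Cf)|exact: (Ck_continuous Cg)].
apply: Ck_add.
  exact: IH (Ck_partial i Cf) (Ck_pred Cg).
exact: IH (Ck_pred Cf) (Ck_partial i Cg).
Qed.

Lemma Ck_cst k (c : R) : Ck k (cst c).
Proof.
elim: k c => [|k IH] c; first by move=> x; exact: cvg_cst.
have D i x := is_derive_cst c x (std_basis i).
by apply: (CkS _ D) => [x|i]; [exact: cvg_cst|exact: IH].
Qed.

Lemma continuous_exp_inv p : continuous (@exp_inv R p).
Proof.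
move=> y; apply/differentiable_continuous/derivable1_diffP.
by have [] := is_derive_exp_inv p y.
Qed.

Lemma Ck_exp_inv_affine k p (a b : R) j :
  Ck k (fun x : R3 R => exp_inv p (a * coord j x + b)).
Proof.
have C0 q : continuous (fun x : R3 R => exp_inv q (a * coord j x + b)).
  move=> x; apply: (@continuous_comp _ _ _ (fun x : R3 R => a * coord j x + b)).
    apply: cvgD; last exact: cvg_cst.
    by apply: cvgM; [exact: cvg_cst|exact: continuous_coord].
  exact: continuous_exp_inv.
elim: k p => [//|k IH] p.
have dL i x : is_derive x (std_basis i) (fun x : R3 R => a * coord j x + b) (a * (i == j)%:R).
  have H : is_derive x (std_basis i) (fun x : R3 R => a * coord j x + b) _ :=
    is_derive_add (is_derive_scale a (is_derive_coord i j x)) (is_derive_cst b x (std_basis i)).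
  by apply: (is_derive_eq H); rewrite addr0.
have D i x := @is_derive_chain _ _ _
  (fun x : R3 R => a * coord j x + b) _ _ _ _
  (is_derive_exp_inv p (a * coord j x + b)) (dL i x).
apply: (CkS _ D) => [|i]; first exact: C0.
by apply: Ck_mul; [exact: IH|exact: Ck_cst].
Qed.

(** With N = n+1, each coordinate contributes exp(-1/(N (x_j - p_j))) exp(-1/(N (q_j - x_j))). The
    product is smooth, positive exactly on the open box with corners [p], [q], and tends to 1 there
    as N grows. The arguments are expanded to the affine form of [Ck_exp_inv_affine]. *)
Definition obox_bump (p q : R3 R) (n : nat) (x : R3 R) : R :=
  \prod_(j < 3) (exp_inv 1 (n.+1%:R * coord j x - n.+1%:R * coord j p)
                 * exp_inv 1 (- n.+1%:R * coord j x + n.+1%:R * coord j q)).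

Lemma obox_bump_Ck p q n k : Ck k (obox_bump p q n).
Proof.
rewrite /obox_bump; under [X in Ck k X]funext => x do rewrite !big_ord_recl big_ord0.
by do 4?[apply: Ck_mul]; try exact: Ck_exp_inv_affine; exact: Ck_cst.
Qed.

End Smooth.

(** * Weak and classical derivatives *)

Section Density.
Context d (T : measurableType d) (R : realType) (mu : {measure set T -> \bar R}).
Local Open Scope ereal_scope.

(** The arguments [mh] and [h0] allow the measure structure to be inferred from the term itself. *)
Definition density (h : T -> \bar R) (mh : measurable_fun setT h)
  (h0 : forall x, 0 <= h x) (A : set T) : \bar R := \int[mu]_(x in A) h x.

Variables (h : T -> \bar R) (mh : measurable_fun setT h) (h0 : forall x, 0 <= h x).

Let density0 : density mh h0 set0 = 0.
Proof. by rewrite /density integral_set0. Qed.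

Let density_ge0 A : 0 <= density mh h0 A.
Proof. by apply: integral_ge0 => x _; exact: h0. Qed.

Let density_sigma_additive : semi_sigma_additive (density mh h0).
Proof.
move=> F mF tF mUF; rewrite /density ge0_integral_bigcup//; last first.
  exact: measurable_funTS.
apply: is_cvg_ereal_nneg_natsum_cond => n _ _.
by apply: integral_ge0 => x _; exact: h0.
Qed.

HB.instance Definition _ := isMeasure.Build _ _ _ (density mh h0)
  density0 density_ge0 density_sigma_additive.

End Density.

Section OpenBoxes.
Context {R : realType}.
Implicit Types p q : R3 R.

Definition obox p q : set (mR3 R) :=
  ([set` `]p.1.1, q.1.1[] `*` [set` `]p.1.2, q.1.2[]) `*` [set` `]p.2, q.2[].

Lemma measurable_obox p q : measurable (obox p q).
Proof.
by apply: measurableX; [apply: measurableX|]; exact: measurable_itv.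
Qed.

Lemma oboxP p q (x : R3 R) :
  obox p q x <-> forall j, coord j p < coord j x < coord j q.
Proof.
split=> [[[/= h0 h1] h2] j|h].
  move: h0 h1 h2; rewrite !in_itv/= /coord.
  by case: j => [[|[|[|]]]].
have h0 := h (@Ordinal 3 0 isT); have h1 := h (@Ordinal 3 1 isT).
have h2 := h (@Ordinal 3 2 isT).
by split; [split|]; rewrite /= in_itv/=.
Qed.

Definition oboxes : set (set (mR3 R)) := [set A | exists p q, A = obox p q].

Lemma setI_closed_oboxes : setI_closed oboxes.
Proof.
move=> _ _ [p [q ->]] [p' [q' ->]].
exists (Num.max p.1.1 p'.1.1, Num.max p.1.2 p'.1.2, Num.max p.2 p'.2).
exists (Num.min q.1.1 q'.1.1, Num.min q.1.2 q'.1.2, Num.min q.2 q'.2).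
apply/seteqP; split=> x; rewrite /obox /= !in_itv/= !gt_max !lt_min.
  by move=> [[[/andP[-> ->] /andP[-> ->]] /andP[-> ->]]
             [[/andP[-> ->] /andP[-> ->]] /andP[-> ->]]].
by move=> [[/andP[/andP[-> ->] /andP[-> ->]] /andP[/andP[-> ->] /andP[-> ->]]]
   /andP[/andP[-> ->] /andP[-> ->]]].
Qed.

Definition centered (r : R) : R3 R := (r, r, r).

Lemma bigcup_oboxT : \bigcup_n obox (centered (- n%:R)) (centered n%:R) = setT.
Proof.
apply/seteqP; split=> // x _.
have nbound (a : R) (n : nat) : (Num.truncn `|a| < n)%N -> - n%:R < a < n%:R.
  move=> an; rewrite -ltr_norml.
  have /andP[_ h] := truncn_itv (normr_ge0 a).
  by rewrite (lt_le_trans h)// ler_nat.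
pose n := (Num.truncn `|x.1.1| + Num.truncn `|x.1.2| + Num.truncn `|x.2|).+1.
exists n => //; apply/oboxP => j.
by rewrite /coord/=; case: (val j) => [|[|_]]; apply: nbound;
  rewrite /n ltnS ?leq_addl// -?addnA ?leq_addr// addnCA leq_addr.
Qed.

(** A half-space x_j > a is the union over n of the boxes with j-th lower end [a] and all other ends
    -n or n. So the coordinates, and with them the identity map, are measurable for the generated
    sigma-algebra. *)
Lemma measurable_oboxes : @measurable _ (mR3 R) = <<s oboxes >>.
Proof.
apply/seteqP; split; last first.
  apply: smallest_sub; first exact: sigma_algebra_measurable.
  by move=> _ [p [q ->]]; exact: measurable_obox.
pose T := g_sigma_algebraType oboxes.
have coordM j : measurable_fun setT (coord j : T -> measurableTypeR R).
  apply: (measurability _ (RGenOInfty.measurableE R)).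
  move=> _ [_ [a ->] <-]; rewrite setTI.
  pose p n : R3 R := (if val j == 0%N then a else - n%:R,
    if val j == 1%N then a else - n%:R, if val j == 2%N then a else - n%:R).
  have -> : (coord j : T -> R) @^-1` `]a, +oo[ =
      \bigcup_n obox (p n) (centered n%:R).
    apply/seteqP; split=> [x|x [n _ /oboxP/(_ j)]]; last first.
      rewrite /= in_itv/= andbT => /andP[+ _]; rewrite /p /coord; clear p.
      by case: j => [[|[|[|]]]].
    rewrite /= in_itv/= andbT => ax.
    have : (\bigcup_n obox (centered (- n%:R)) (centered n%:R)) x.
      by rewrite bigcup_oboxT.
    move=> [n _ /oboxP nx]; exists n => //; apply/oboxP => i.
    have /andP[+ xi] := nx i; rewrite xi andbT {xi nx}; move: ax; rewrite /p /coord /centered; clear p.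
    by case: i => [[|[|[|]]]]//= _; case: j => [[|[|[|]]]].
  by apply: bigcup_measurable => n _; apply: sub_sigma_algebra; exists (p n), (centered n%:R).
have idM : measurable_fun setT (fun x : T => (x : mR3 R)).
  apply/measurable_fun_pairP; split; last exact: (coordM (@Ordinal 3 2 isT)).
  apply/measurable_fun_pairP; split.
    exact: (coordM (@Ordinal 3 0 isT)).
  exact: (coordM (@Ordinal 3 1 isT)).
move=> A mA; have := idM measurableT A mA.
by rewrite setTI.
Qed.

End OpenBoxes.

Section VanishingBoxIntegrals.
Context {R : realType}.
Local Open Scope ereal_scope.

Lemma obox_sub_box (p q : R3 R) : exists r : R, obox p q `<=` box r.
Proof.
pose r : R := (\sum_(j < 3) (`|coord j p| + `|coord j q|))%R; exists r.
move=> x /oboxP pxq; apply/box_coord => j.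
have : (`|coord j p| + `|coord j q| <= r)%R.
  by rewrite /r (bigD1 j)//= lerDl sumr_ge0// => i _; rewrite addr_ge0.
have /andP[px xq] := pxq j; apply: le_trans.
rewrite ler_norml; apply/andP; split.
  have := lerNnormlW (lexx `|coord j p|%R); have := normr_ge0 (coord j q); lra.
have := ler_norm (coord j q); have := normr_ge0 (coord j p); lra.
Qed.

(** The positive and negative parts of [f] are densities of two measures that agree, with finite
    values, on the boxes. These are stable under intersection and exhaust the space, so the measures
    coincide on all Borel sets. *)
Lemma ae_eq0_obox (f : mR3 R -> \bar R) : measurable_fun setT f ->
  (forall r, mu3.-integrable (box r) f) ->
  (forall p q, \int[mu3]_(x in obox p q) f x = 0) ->
  ae_eq mu3 setT f (cst 0).
Proof.
move=> mf fi f0.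
have mp := measurable_funepos mf; have mn := measurable_funeneg mf.
have iob p q : mu3.-integrable (obox p q) f.
  have [r pqr] := obox_sub_box p q.
  by apply: (integrableS _ _ pqr (fi r)); [exact: measurable_box|exact: measurable_obox].
pose m1 := density mu3 mp (funepos_ge0 f).
pose m2 := density mu3 mn (funeneg_ge0 f).
have fin1 p q : m1 (obox p q) < +oo.
  by apply: integral_funepos_lt_pinfty; [exact: measurable_obox|exact: iob].
have fin2 p q : m2 (obox p q) < +oo.
  by apply: integral_funeneg_lt_pinfty; [exact: measurable_obox|exact: iob].
have m12 A : oboxes A -> m1 A = m2 A.
  move=> [p [q ->]]; have f2 : m2 (obox p q) \is a fin_num by rewrite ge0_fin_numE.
  rewrite -[LHS](subeK _ f2) -[RHS]add0e; congr (_ + _).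
  by rewrite -[RHS](f0 p q) integralE.
have H A : measurable A -> m1 A = m2 A.
  apply: (measure_unique oboxes (fun n => obox (centered (- n%:R)) (centered n%:R))) => //.
  - exact: measurable_oboxes.
  - exact: setI_closed_oboxes.
  - by move=> n; exists (centered (- n%:R)), (centered n%:R).
  - exact: bigcup_oboxT.
(* The negative part is 0 on [A] and the positive part is 0 off [A], so both measures have total
   mass [m1 A = m2 A = 0]. *)
pose A := [set x | 0 < f x].
have mA : measurable A by rewrite /A -[X in measurable X]setTI; exact: emeasurable_fun_o_infty.
have m2A : m2 A = 0.
  apply: integral0_eq => x; rewrite /A/= => fx0.
  by rewrite funenegE max_r// oppe_le0 ltW.
have m1T : m1 setT = 0.
  rewrite -[RHS]m2A -H// /m1 /density [RHS]integral_mkcond.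
  apply: eq_integral => x _; rewrite patchE; case: ifPn => // /negP xA.
  rewrite funeposE max_r// leNgt; apply/negP => fx0; apply: xA.
  by rewrite inE.
have m2T : m2 setT = 0 by rewrite -H.
have Z (g : mR3 R -> \bar R) : measurable_fun setT g -> (forall x, 0 <= g x) ->
    \int[mu3]_x g x = 0 -> ae_eq mu3 setT g (cst 0).
  move=> mg g0 ig; apply/(ae_eq_integral_abs mu3 measurableT mg).
  by rewrite -[RHS]ig; apply: eq_integral => x _; rewrite gee0_abs.
have := Z _ mp (funepos_ge0 f) m1T; have := Z _ mn (funeneg_ge0 f) m2T.
apply: filterS2 => x /= /(_ I) fn /(_ I) fp _.
by rewrite [f](funeposneg f) fn fp sube0.
Qed.

End VanishingBoxIntegrals.

Section Integrability.
Context {R : realType}.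
Implicit Types f g : R3 R -> R.

Lemma dominated_integrable f g :
  measurable_fun [set: mR3 R] (f : mR3 R -> measurableTypeR R) ->
  mu3.-integrable setT (EFin \o g) -> (forall x, `|f x| <= g x) ->
  mu3.-integrable setT (EFin \o f).
Proof.
move=> mf ig fg; apply: le_integrable ig => //; first exact/measurable_EFinP.
by move=> x _; rewrite /= lee_fin (le_trans (fg x))// ler_norm.
Qed.

Lemma integrable_add f g : mu3.-integrable setT (EFin \o f) ->
  mu3.-integrable setT (EFin \o g) ->
  mu3.-integrable setT (EFin \o (fun x => f x + g x)).
Proof.
move=> fi gi; have := @integrableD _ _ _ mu3 _ measurableT _ _ fi gi.
by apply: eq_integrable.
Qed.

Lemma integrable_scale c f : mu3.-integrable setT (EFin \o f) ->
  mu3.-integrable setT (EFin \o (fun x => c * f x)).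
Proof.
move=> fi; have := @integrableZl _ _ _ mu3 _ measurableT c _ fi.
by apply: eq_integrable.
Qed.

Lemma L2_measurable f : L2 f -> measurable_fun [set: mR3 R] (f : mR3 R -> measurableTypeR R).
Proof. by rewrite /L2 inE => /andP[+ _]; rewrite inE. Qed.

Lemma L2_sqr_integrable f : L2 f ->
  mu3.-integrable setT (EFin \o (fun x => f x ^+ 2)).
Proof. exact: Lfun2_integrable_sqr. Qed.

Lemma box_indic_integrable r : mu3.-integrable setT (EFin \o (\1_(box r : set (R3 R)) : R3 R -> R)).
Proof.
apply: (@bounded_support_integrable _ _ _ _ (box `|r|) 1) => //.
- exact: measurable_indic (measurable_box r).
- exact: measurable_box.
- by rewrite mu3_box// ltry.
- by move=> x; rewrite indicE; case: (_ \in _); rewrite ?normr1 ?normr0.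
- move=> x nx; rewrite indicE; case: (boolP (x \in _)) => //; rewrite inE => bx.
  exfalso; apply: nx; apply/box_coord => j; have /box_coord/(_ j) := bx.
  by move/le_trans; apply; exact: ler_norm.
Qed.

(* [|g f| <= M (g^2 + 1_box)], by AM-GM. *)
Lemma L2_mul_integrable r M g f : L2 g ->
  measurable_fun [set: mR3 R] (f : mR3 R -> measurableTypeR R) ->
  (forall x, `|f x| <= M) -> supported r f ->
  mu3.-integrable setT (EFin \o (fun x => g x * f x)).
Proof.
move=> Lg mf fM sf.
have M0 : 0 <= M by exact: le_trans (fM 0).
apply: (@dominated_integrable _ (fun x => M * (g x ^+ 2 + \1_(box r) x))).
- by apply: measurable_funM => //; exact: L2_measurable.
- apply: integrable_scale; apply: integrable_add; first exact: L2_sqr_integrable.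
  exact: box_indic_integrable.
- move=> x; rewrite normrM; have [bx|bx] := pselect (box r x); last first.
    rewrite (supported_box sf bx) normr0 mulr0 mulr_ge0// addr_ge0// ?sqr_ge0//.
  have -> : \1_(box r) x = 1 :> R by rewrite indicE mem_set.
  rewrite mulrC ler_pM//.
  rewrite -(real_normK (num_real (g x))); have := sqr_ge0 (`|g x| - 1); have := normr_ge0 (g x).
  nra.
Qed.

End Integrability.

Section Bump.
Context {R : realType}.
Implicit Types p q : R3 R.

Lemma exp_inv1_itv (y : R) : 0 <= exp_inv 1 y <= 1.
Proof.
rewrite /exp_inv; case: ifP => [y0|_]; last by rewrite lexx ler01.
by rewrite hornerC mul1r expR_ge0 expR_le1 oppr_le0 invr_ge0 ltW.
Qed.

Lemma obox_bump_itv p q n x : 0 <= obox_bump p q n x <= 1.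
Proof.
rewrite /obox_bump; apply/andP; split.
  apply: prodr_ge0 => j _; apply: mulr_ge0.
    by have /andP[] := exp_inv1_itv (n.+1%:R * coord j x - n.+1%:R * coord j p).
  by have /andP[] := exp_inv1_itv (- n.+1%:R * coord j x + n.+1%:R * coord j q).
apply: prodr_ile1 => j _.
have /andP[a0 a1] := exp_inv1_itv (n.+1%:R * coord j x - n.+1%:R * coord j p).
have /andP[b0 b1] := exp_inv1_itv (- n.+1%:R * coord j x + n.+1%:R * coord j q).
by rewrite mulr_ge0//= mulr_ile1.
Qed.

Lemma obox_bump_out p q n x : ~ obox p q x -> obox_bump p q n x = 0.
Proof.
move=> nx; have /existsNP[j /negP] : ~ forall j, coord j p < coord j x < coord j q.
  by move=> h; apply: nx; apply/oboxP.
rewrite negb_and -!leNgt => /orP h; rewrite /obox_bump (bigD1 j)//=.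
suff -> : exp_inv 1 (n.+1%:R * coord j x - n.+1%:R * coord j p) *
  exp_inv 1 (- n.+1%:R * coord j x + n.+1%:R * coord j q) = 0 by rewrite mul0r.
case: h => h.
  by rewrite /exp_inv subr_gt0 ltr_pM2l// ltNge h mul0r.
by rewrite mulrC /exp_inv mulNr addrC subr_gt0 ltr_pM2l// ltNge h mul0r.
Qed.

Lemma cvg_exp_inv (d : R) : 0 < d -> exp_inv 1 (n.+1%:R * d) @[n --> \oo] --> (1 : R).
Proof.
move=> d0.
have -> : (fun n => exp_inv 1 (n.+1%:R * d)) = (fun n => expR (- (d^-1 * n.+1%:R^-1))).
  by apply/funext => n; rewrite /exp_inv mulr_gt0// hornerC mul1r invfM mulrC.
suff H : - (d^-1 * n.+1%:R^-1) @[n --> \oo] --> (0 : R).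
  have := cvg_comp _ _ H (@continuous_expR R 0).
  by rewrite expR0.
have H : d^-1 * n.+1%:R^-1 @[n --> \oo] --> (d^-1 * 0 : R).
  by apply: cvgM; [exact: cvg_cst|exact: (@cvg_harmonic R)].
by move/cvgN : H; rewrite mulr0 oppr0.
Qed.

Lemma cvg_obox_bump p q x : obox_bump p q n x @[n --> \oo] --> (\1_(obox p q) x : R).
Proof.
have [ox|nx] := pselect (obox p q x); last first.
  rewrite indicE memNset// (_ : (fun n => obox_bump p q n x) = cst 0); first exact: cvg_cst.
  by apply/funext => n; rewrite obox_bump_out.
rewrite indicE mem_set//=.
have -> : (1%:R : R) = \prod_(j < 3) (1 * 1) by rewrite big1 ?mulr1// => *; rewrite mulr1.
move/oboxP in ox.
rewrite /obox_bump; apply: cvg_big => [|j _]; first exact: mul_continuous.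
have /andP[h1 h2] := ox j.
apply: cvgM.
  have /cvg_exp_inv : 0 < coord j x - coord j p by rewrite subr_gt0.
  by under eq_fun do rewrite mulrBr.
have /cvg_exp_inv : 0 < coord j q - coord j x by rewrite subr_gt0.
by under eq_fun do rewrite mulrBr addrC -mulNr.
Qed.

Lemma obox_bump_test p q n : test_function (obox_bump p q n).
Proof.
split=> [k|]; first exact: obox_bump_Ck.
have [r pqr] := obox_sub_box p q.
apply: (subclosed_compact _ (@compact_box _ r)); first exact: closed_closure.
rewrite (_ : box r = closure (box r)).
  by apply: closure_subset => x /= /eqP bx; apply: pqr; apply: contrapT => /(@obox_bump_out _ _ n)/bx.
apply/closure_id; apply: compact_closed; last exact: compact_box.
exact: norm_hausdorff.
Qed.

End Bump.

Section WeakPartial.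
Context {R : realType}.
Implicit Types f g u phi : R3 R -> R.

Lemma supported_mul r f phi : supported r phi -> supported r (fun x => f x * phi x).
Proof. by move=> sp x i rx; rewrite (sp x i rx) mulr0. Qed.

Lemma continuous_mul f g : continuous f -> continuous g ->
  continuous (fun x => f x * g x).
Proof. by move=> cf cg x; apply: cvgM; [exact: cf|exact: cg]. Qed.

Lemma supported_mul_integrable r f phi : continuous f -> continuous phi ->
  supported r phi -> mu3.-integrable setT (EFin \o (fun x => f x * phi x)).
Proof.
move=> cf cp sp; apply: (@supported_integrable _ r).
  exact: continuous_mul.
exact: supported_mul.
Qed.

Lemma integration_by_parts_supported r f phi i : Ck 1 f -> Ck 1 phi ->
  supported r phi ->
  \int[mu3]_x (f x * partial i phi x) = - \int[mu3]_x (partial i f x * phi x).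
Proof.
move=> Cf Cp sp.
have cf := Ck_continuous Cf; have cp := Ck_continuous Cp.
have cdf := Ck_continuous (Ck_partial i Cf).
have cdp := Ck_continuous (Ck_partial i Cp).
have D x := is_derive_mul (Ck_derive i x Cf) (Ck_derive i x Cp).
have E : partial i (fun x => f x * phi x) =
    fun x => partial i f x * phi x + f x * partial i phi x.
  by apply/funext => x; exact: (partial_eq (D x)).
have := @integral_partial _ r (fun x => f x * phi x) i (@supported_mul r f phi sp)
  (fun x => is_derive_derivable (D x)).
rewrite E => H0.
have i1 := supported_mul_integrable cdf cp sp.
have i2 := supported_mul_integrable cf cdp (@supported_partial _ r phi i sp).
apply/eqP; rewrite -addr_eq0 addrC -RintegralD//; apply/eqP.
rewrite /Rintegral H0// => x; apply: cvgD.
  exact: continuous_mul.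
exact: continuous_mul.
Qed.

Lemma weak_partial_test i u g r phi : Ck 1 u -> weak_partial i u g ->
  test_function phi -> supported r phi ->
  \int[mu3]_x ((partial i u x - g x) * phi x) = 0.
Proof.
move=> Cu [Lg wg] tp sp; have Cp := tp.1 1%N.
have cp := Ck_continuous Cp.
have [M HM] := continuous_supported_bounded cp sp.
have i1 := supported_mul_integrable (Ck_continuous (Ck_partial i Cu)) cp sp.
have i2 := L2_mul_integrable Lg (continuous_measurable_R3 cp) HM sp.
have := wg phi tp; rewrite (integration_by_parts_supported i Cu Cp sp) => /oppr_inj H.
under eq_Rintegral do rewrite mulrBl.
by rewrite RintegralB// H subrr.
Qed.

Lemma continuous_integrable_box r f : continuous f ->
  mu3.-integrable (box r) (EFin \o f).
Proof.
move=> cf; apply: measurable_bounded_integrable; first exact: measurable_box.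
- have [r0|r0] := leP 0 r; first by rewrite mu3_box// ltry.
  rewrite (_ : box r = set0) ?measure0//; apply/seteqP; split=> // x /box_coord.
  by move=> /(_ ord0) /(le_trans (normr_ge0 _)); rewrite leNgt r0.
- by apply: measurable_funTS; exact: (continuous_measurable_R3 cf).
- have [M HM] := continuous_box_bounded r cf.
  exists M; split; first exact: num_real.
  by move=> y My x bx; rewrite /= (le_trans (HM x bx))// ltW.
Qed.

(** |g| <= g^2 + 1, and the box has finite volume. *)
Lemma L2_integrable_box r g : L2 g -> mu3.-integrable (box r) (EFin \o g).
Proof.
move=> Lg; have mg := L2_measurable Lg.
have c1 : continuous (cst 1 : R3 R -> R) by move=> x; exact: cvg_cst.
have H : mu3.-integrable (box r) (fun x => ((g x ^+ 2)%:E + 1%:E)%E).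
  apply: integrableD; first exact: measurable_box.
    by apply: integrableS (L2_sqr_integrable Lg) => //; exact: measurable_box.
  exact: (continuous_integrable_box r c1).
apply: le_integrable H; first exact: measurable_box.
  exact/measurable_EFinP/measurable_funTS.
move=> x _; rewrite /= lee_fin [leRHS]ger0_norm; last by rewrite addr_ge0// sqr_ge0.
rewrite -(real_normK (num_real (g x))).
have := sqr_ge0 (`|g x| - 1); have := normr_ge0 (g x); nra.
Qed.

(** Testing against [obox_bump p q n] gives 0 for each n. The bumps are at most 1 and converge to
    the indicator of the box, so dominated convergence applies with |f| on an enclosing closed
    box. *)
Lemma weak_partial_obox i u g p q : Ck 1 u -> weak_partial i u g ->
  (\int[mu3]_(x in obox p q) (partial i u x - g x)%:E = 0)%E.
Proof.
move=> Cu wg; have [Lg _] := wg.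
have [r pqr] := obox_sub_box p q.
have cD := Ck_continuous (Ck_partial i Cu).
pose f x := partial i u x - g x.
have mf : measurable_fun [set: mR3 R] (f : mR3 R -> measurableTypeR R).
  by apply: measurable_funB; [exact: continuous_measurable_R3|exact: L2_measurable].
have fi : mu3.-integrable (box r) (EFin \o f).
  have := integrableB (measurable_box r) (continuous_integrable_box r cD) (L2_integrable_box r Lg).
  by apply: eq_integrable; first exact: measurable_box.
pose F n (x : mR3 R) := (f x * obox_bump p q n x)%:E.
have F0 n : (\int[mu3]_x F n x = 0)%E.
  have sp : supported r (obox_bump p q n).
    move=> x j rx; apply: obox_bump_out => /pqr /box_coord /(_ j).
    by rewrite leNgt rx.
  have tp := obox_bump_test p q n.
  have cp := Ck_continuous (tp.1 0%N).
  have [M HM] := continuous_supported_bounded cp sp.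
  have := weak_partial_test Cu wg tp sp; rewrite /Rintegral => H.
  (* [fine] also sends infinite values to 0, so the vanishing real integral determines the extended
     one only once integrability is known. *)
  rewrite -[LHS]fineK; first by rewrite H.
  have i1 := supported_mul_integrable cD cp sp.
  have i2 := L2_mul_integrable Lg (continuous_measurable_R3 cp) HM sp.
  apply: integrable_fin_num => //.
  have := integrableB measurableT i1 i2.
  by apply: eq_integrable => // x _; rewrite /= -EFinB -mulrBl.
have mp n : measurable_fun [set: mR3 R] (obox_bump p q n : mR3 R -> measurableTypeR R).
  exact: (continuous_measurable_R3 (Ck_continuous (obox_bump_Ck p q n 0%N))).
have mF n : measurable_fun setT (F n).
  by apply/measurable_EFinP; apply: measurable_funM; [exact: mf|exact: mp].
pose G (x : mR3 R) := ((EFin \o f) \_ (obox p q)) x.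
have mG : measurable_fun setT G.
  have h : measurable_fun (obox p q) (EFin \o f).
    by apply: measurable_funTS; exact/measurable_EFinP.
  exact: (proj1 (measurable_restrictT _ (measurable_obox p q)) h).
pose H (x : mR3 R) := ((abse \o (EFin \o f)) \_ (box r)) x.
have iH : mu3.-integrable setT H.
  have ia := integrable_abse fi.
  exact: (proj1 (integrable_mkcond _ (measurable_box r)) ia).
have FG : {ae mu3, forall x, setT x -> F ^~ x @ \oo --> G x}.
  apply: aeW => x _; rewrite /F /G patchE.
  have -> : (if x \in obox p q then (EFin \o f) x else 0%E) = (f x * \1_(obox p q) x)%:E.
    by rewrite indicE; case: (x \in _); rewrite ?mulr1 ?mulr0.
  apply: cvg_EFin; first exact: nearW.
  by apply: cvgM; [exact: cvg_cst|exact: cvg_obox_bump].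
have FH : {ae mu3, forall x n, setT x -> (`|F n x| <= H x)%E}.
  apply: aeW => x n _; rewrite /F /H patchE.
  have [ox|nx] := pselect (obox p q x); last first.
    rewrite (obox_bump_out _ nx) mulr0 abse0; case: ifP => // _.
    exact: abse_ge0.
  rewrite mem_set/=; last exact: pqr.
  rewrite lee_fin normrM ler_piMr//.
  by have /andP[b0 b1] := obox_bump_itv p q n x; rewrite ger0_norm.
have [_ _ C] := dominated_convergence measurableT mF mG FG iH FH.
rewrite integral_mkcond.
have C0 : (\int[mu3]_x F n x)%E @[n --> \oo] --> (0 : \bar R).
  by rewrite (_ : (fun n => _) = cst 0%E); [exact: cvg_cst|apply/funext => n; exact: F0].
exact: (cvg_unique _ C C0).
Qed.

Lemma weak_partial_sqr_integrable i u g : Ck 1 u -> weak_partial i u g ->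
  mu3.-integrable setT (EFin \o (fun x => partial i u x ^+ 2)).
Proof.
move=> Cu wg; have [Lg _] := wg.
have cD := Ck_continuous (Ck_partial i Cu).
have mD := continuous_measurable_R3 cD; have mg := L2_measurable Lg.
pose f x := (partial i u x - g x)%:E.
have mf : measurable_fun [set: mR3 R] (f : mR3 R -> \bar R).
  by apply/measurable_EFinP; apply: measurable_funB.
have fi r : mu3.-integrable (box r) f.
  have := integrableB (measurable_box r) (continuous_integrable_box r cD) (L2_integrable_box r Lg).
  by apply: eq_integrable; first exact: measurable_box.
have ae0 := ae_eq0_obox mf fi (fun p q => weak_partial_obox p q Cu wg).
have mD2 : measurable_fun [set: mR3 R] (EFin \o (fun x => partial i u x ^+ 2)).
  by apply/measurable_EFinP; exact: measurable_funX.
have mg2 : measurable_fun [set: mR3 R] (EFin \o (fun x => g x ^+ 2)).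
  by apply/measurable_EFinP; exact: measurable_funX.
apply/integrableP; split=> //.
have /integrableP[_] := L2_sqr_integrable Lg.
apply: le_lt_trans.
have E : ae_eq mu3 setT (abse \o (EFin \o (fun x => partial i u x ^+ 2)))
    (abse \o (EFin \o (fun x => g x ^+ 2))).
  apply: filterS ae0 => x /= /(_ I); rewrite /f => -[/eqP].
  by rewrite subr_eq0 => /eqP -> _.
by rewrite (ae_eq_integral _ _ measurableT _ _ E)//; exact: measurableT_comp.
Qed.

End WeakPartial.

(** * Cutoffs and the divergence theorem *)

Section Cutoff.
Context {R : realType}.
Implicit Types f g : R3 R -> R.

Lemma is_derive_dilate (c : R) f i (x : R3 R) : derivable f (c *: x) (std_basis i) ->
  is_derive x (std_basis i) (fun y : R3 R => f (c *: y)) (c * partial i f (c *: x)).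
Proof.
move=> df; apply: is_derive_of_line.
have -> : (fun s : R => f (c *: (s *: std_basis i + x))) =
    (fun s => f ((c * s) *: std_basis i + c *: x)).
  by apply/funext => s; rewrite scalerDr scalerA.
have E : (c * 0) *: std_basis i + c *: x = c *: x by rewrite mulr0 scale0r add0r.
have dl : is_derive (c * 0) (1 : R) (fun s : R => f (s *: std_basis i + c *: x))
    (partial i f (c *: x)).
  rewrite -[in partial i f _]E; apply: (is_derive_line (f := f)); rewrite E.
  exact: df.
have dc : is_derive (0 : R) (1 : R) (fun s : R => c * s) (c * 1).
  exact: is_derive_scale.
apply: (is_derive_eq (@is_derive_chain _ _ _ (fun s : R => c * s) _ _ _ _ dl dc)).
by rewrite mulr1 mulrC.
Qed.

Lemma continuous_dilate (c : R) f : continuous f -> continuous (fun x : R3 R => f (c *: x)).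
Proof.
move=> cf x; apply: (@continuous_comp _ _ _ (fun x : R3 R => c *: x) f).
  exact: scaler_continuous.
exact: cf.
Qed.

Lemma Ck_dilate k (c : R) f : Ck k f -> Ck k (fun x : R3 R => f (c *: x)).
Proof.
elim: k f => [|k IH] f Cf; first exact: continuous_dilate.
have D i x := is_derive_dilate (is_derive_derivable (Ck_derive i (c *: x) Cf)).
apply: (CkS _ D) => [|i]; first exact: continuous_dilate (Ck_continuous Cf).
by apply: Ck_mul; [exact: Ck_cst|apply: IH; exact: Ck_partial].
Qed.

Lemma coord_dilate (c : R) i (x : R3 R) : coord i (c *: x) = c * coord i x.
Proof. by rewrite /coord; case: (val i) => [|[|_]]. Qed.

Lemma supported_dilate r n f : supported r f ->
  supported (n.+1%:R * r) (fun x : R3 R => f (n.+1%:R^-1 *: x)).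
Proof.
move=> sf x i rx; apply: (sf _ i); rewrite coord_dilate normrM gtr0_norm//.
by rewrite mulrC ltr_pdivlMr// mulrC.
Qed.

(** Its value at 0 is exp(-6), not 1: limits along dilations carry this positive constant as a
    factor. *)
Definition cutoff0 : R3 R -> R := obox_bump (centered (-1)) (centered 1) 0.

Definition cutoff n (x : R3 R) : R := cutoff0 (n.+1%:R^-1 *: x).

Lemma cutoff0_Ck k : Ck k cutoff0. Proof. exact: obox_bump_Ck. Qed.

Lemma cutoff_Ck n k : Ck k (cutoff n).
Proof. by apply: Ck_dilate; exact: cutoff0_Ck. Qed.

Lemma cutoff0_supported : supported 1 cutoff0.
Proof.
move=> x i xi; apply: obox_bump_out => /oboxP/(_ i); rewrite [coord i (centered 1)](_ : _ = 1).
  rewrite [coord i (centered (-1))](_ : _ = -1); last first.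
    by rewrite /coord/=; case: (val i) => [|[|_]].
  by rewrite -ltr_norml ltNge (ltW xi).
by rewrite /coord/=; case: (val i) => [|[|_]].
Qed.

Lemma cutoff_supported n : supported n.+1%:R (cutoff n).
Proof. by rewrite -[n.+1%:R]mulr1; apply: supported_dilate; exact: cutoff0_supported. Qed.

Lemma cutoff_itv n x : 0 <= cutoff n x <= 1.
Proof. exact: obox_bump_itv. Qed.

Lemma cutoff0_gt0 : 0 < cutoff0 0.
Proof.
rewrite /cutoff0 /obox_bump; apply: prodr_gt0 => j _.
have c0 : coord j (0 : R3 R) = 0 by rewrite /coord; case: (val j) => [|[|_]].
have c1 (r : R) : coord j (centered r) = r by rewrite /coord; case: (val j) => [|[|_]].
rewrite c0 !c1 !mulr0 mulrN1 opprK !mulr1 !add0r.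
by rewrite /exp_inv ltr01 hornerC mul1r mulr_gt0// expR_gt0.
Qed.

Lemma cvg_dilate f x : continuous f -> f (n.+1%:R^-1 *: x) @[n --> \oo] --> f 0.
Proof.
move=> cf.
have H : n.+1%:R^-1 *: x @[n --> \oo] --> (0 : R) *: x.
  by apply: cvgZr_tmp; exact: (@cvg_harmonic R).
rewrite scale0r in H.
exact: cvg_comp H (cf 0).
Qed.

Lemma cvg_cutoff x : cutoff n x @[n --> \oo] --> cutoff0 0.
Proof. exact: cvg_dilate (Ck_continuous (cutoff0_Ck 0)). Qed.

Lemma partial_cutoff n i x :
  partial i (cutoff n) x = n.+1%:R^-1 * partial i cutoff0 (n.+1%:R^-1 *: x).
Proof.
apply: partial_eq; apply: is_derive_dilate.
exact: (is_derive_derivable (Ck_derive i _ (cutoff0_Ck 1))).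
Qed.

Lemma partial2_cutoff n i x : partial i (partial i (cutoff n)) x =
  (n.+1%:R ^+ 2)^-1 * partial i (partial i cutoff0) (n.+1%:R^-1 *: x).
Proof.
have -> : partial i (cutoff n) = (fun x => n.+1%:R^-1 * partial i cutoff0 (n.+1%:R^-1 *: x)).
  by apply/funext => y; exact: partial_cutoff.
rewrite expr2 invfM -mulrA; apply: partial_eq; apply: is_derive_scale.
apply: (is_derive_dilate (f := partial i cutoff0)).
exact: (is_derive_derivable (Ck_derive i _ (Ck_partial i (cutoff0_Ck 2)))).
Qed.

(** The derivative has a factor 1/(n+1) and vanishes unless every |x_j| <= n+1, where 1 + sum_j
    |x_j| <= 4 (n+1); hence the constant 4. *)
Lemma partial_cutoff_bound : exists2 M : R, 0 <= M & forall n i x,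
  `|partial i (cutoff n) x| <= n.+1%:R^-1 * M /\
  `|partial i (cutoff n) x| * (1 + \sum_(j < 3) `|coord j x|) <= M.
Proof.
have B i : exists M, forall x, `|partial i cutoff0 x| <= M.
  apply: (@continuous_supported_bounded _ 1).
    exact: Ck_continuous (Ck_partial i (cutoff0_Ck 1)).
  exact: (@supported_partial _ 1 cutoff0 i cutoff0_supported).
have {B} [M HM] : exists M : 'I_3 -> R, forall i x, `|partial i cutoff0 x| <= M i.
  by exists (fun i => projT1 (cid (B i))) => i; exact: projT2 (cid (B i)).
pose M1 := \sum_(i < 3) `|M i|.
have HM1 i x : `|partial i cutoff0 x| <= M1.
  rewrite (le_trans (HM i x))// /M1 (bigD1 i)//= (le_trans (ler_norm _))// lerDl.
  exact: sumr_ge0.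
have M10 : 0 <= M1 by exact: sumr_ge0.
exists (4 * M1); first by rewrite mulr_ge0.
move=> n i x; rewrite partial_cutoff normrM (gtr0_norm (x := n.+1%:R^-1))//; split.
  by rewrite ler_wpM2l// (le_trans (HM1 i _))// ler_peMl// ler1n.
have [h|h] := pselect (box 1 (n.+1%:R^-1 *: x)); last first.
  rewrite (supported_box (@supported_partial _ 1 cutoff0 i cutoff0_supported) h).
  by rewrite normr0 mulr0 mul0r mulr_ge0.
rewrite mulrAC mulrC mulrC ler_pM//.
  by rewrite mulr_ge0// addr_ge0// sumr_ge0.
rewrite mulrDr mulr1 (_ : 4 = 1 + 3)//; apply: lerD.
  by rewrite invf_le1// ler1n.
rewrite mulr_sumr (le_trans (y := \sum_(j < 3) 1))//; last by rewrite sumr_const card_ord.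
apply: ler_sum => j _; have /box_coord/(_ j) := h.
by rewrite coord_dilate normrM gtr0_norm.
Qed.

End Cutoff.

Section Limits.
Context {R : realType}.
Implicit Types f g : R3 R -> R.

Lemma Rdominated_cvg (f_ : nat -> R3 R -> R) f g :
  (forall n, measurable_fun [set: mR3 R] (f_ n : mR3 R -> measurableTypeR R)) ->
  measurable_fun [set: mR3 R] (f : mR3 R -> measurableTypeR R) ->
  (forall x, f_ n x @[n --> \oo] --> f x) ->
  mu3.-integrable setT (EFin \o g) -> (forall n x, `|f_ n x| <= g x) ->
  \int[mu3]_x f_ n x @[n --> \oo] --> \int[mu3]_x f x.
Proof.
move=> mf_ mf cf ig fg.
have mF n : measurable_fun [set: mR3 R] (EFin \o f_ n) by apply/measurable_EFinP; exact: mf_.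
have mG : measurable_fun [set: mR3 R] (EFin \o f) by exact/measurable_EFinP.
have C : {ae mu3, forall x, setT x -> (EFin \o f_ n) x @[n --> \oo] --> (EFin \o f) x}.
  by apply: aeW => x _; apply: cvg_EFin; [exact: nearW|exact: cf].
have B : {ae mu3, forall x n, setT x -> (`|(EFin \o f_ n) x| <= (EFin \o g) x)%E}.
  by apply: aeW => x n _; rewrite lee_fin.
have [fi _ H] := dominated_convergence measurableT mF mG C ig B.
apply: fine_cvg; rewrite fineK; first exact: H.
exact: integrable_fin_num fi.
Qed.

(** Serves where no dominating function is at hand and integrability of the limit is itself the
    question. *)
Lemma Rfatou (f_ : nat -> R3 R -> R) f (l : R) :
  (forall n, measurable_fun [set: mR3 R] (f_ n : mR3 R -> measurableTypeR R)) ->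
  measurable_fun [set: mR3 R] (f : mR3 R -> measurableTypeR R) ->
  (forall n x, 0 <= f_ n x) ->
  (forall x, f_ n x @[n --> \oo] --> f x) ->
  (forall n, mu3.-integrable setT (EFin \o f_ n)) ->
  \int[mu3]_x f_ n x @[n --> \oo] --> l ->
  mu3.-integrable setT (EFin \o f) /\ \int[mu3]_x f x <= l.
Proof.
move=> mf_ mf f0 cf fi cl.
have f_ge0 x : 0 <= f x.
  by rewrite -(cvg_lim (@Rhausdorff R) (cf x)); apply: limr_ge; [apply/cvg_ex; exists (f x)|exact: nearW].
have mF n : measurable_fun [set: mR3 R] (EFin \o f_ n) by apply/measurable_EFinP; exact: mf_.
have F0 n x : setT x -> (0 <= (EFin \o f_ n) x)%E by rewrite lee_fin.
have einf_lim (u : (\bar R)^nat) m : u @ \oo --> m -> limn_einf u = m.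
  by move=> /cvg_limn_einf_sup[].
have := fatou mu3 measurableT mF F0.
have -> : limn_einf (fun n => (\int[mu3]_x (EFin \o f_ n) x)%E) = l%:E.
  apply: einf_lim.
  have -> : (fun n => (\int[mu3]_x (EFin \o f_ n) x)%E) = (fun n => (\int[mu3]_x f_ n x)%:E).
    by apply/funext => n; rewrite /Rintegral fineK//; exact: integrable_fin_num (fi n).
  by apply: cvg_EFin => //; exact: nearW.
have -> : (\int[mu3]_x limn_einf (fun n => (EFin \o f_ n) x) = \int[mu3]_x (f x)%:E)%E.
  apply: eq_integral => x _; apply: einf_lim.
  by apply: cvg_EFin; [exact: nearW|exact: cf].
move=> H.
have fint : mu3.-integrable setT (EFin \o f).
  apply/integrableP; split; first exact/measurable_EFinP.
  apply: (le_lt_trans _ (ltry l)); apply: le_trans H.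
  by rewrite le_eqVlt; apply/orP; left; apply/eqP; apply: eq_integral => x _ /=; rewrite ger0_norm.
split=> //; rewrite -lee_fin /Rintegral fineK//; exact: integrable_fin_num fint.
Qed.

End Limits.

Section DivergenceTheorem.
Context {R : realType}.
Variables (W : 'I_3 -> R3 R -> R) (K : R3 R -> R).
Hypothesis CW : forall i, Ck 1 (W i).
Hypothesis iK : mu3.-integrable setT (EFin \o K).
Hypothesis WK : forall i x, `|W i x| <= (1 + \sum_(j < 3) `|coord j x|) * K x.

Definition divergence (x : R3 R) : R := \sum_(i < 3) partial i (W i) x.

Lemma continuous_sum3 (f : 'I_3 -> R3 R -> R) : (forall i, continuous (f i)) ->
  continuous (fun x => \sum_(i < 3) f i x).
Proof. by move=> cf x; apply: cvg_big => [|i _]; [exact: add_continuous|exact: cf]. Qed.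

Lemma continuous_divergence : continuous divergence.
Proof. by apply: continuous_sum3 => i; exact: Ck_continuous (Ck_partial i (CW i)). Qed.

Lemma Rintegral_sum3 (f : 'I_3 -> R3 R -> R) :
  (forall i, mu3.-integrable setT (EFin \o f i)) ->
  \int[mu3]_x (\sum_(i < 3) f i x) = \sum_(i < 3) \int[mu3]_x f i x.
Proof.
move=> fi; under eq_Rintegral do rewrite !big_ord_recl big_ord0 addr0.
rewrite !big_ord_recl big_ord0 addr0 RintegralD//; last exact: integrable_add.
by rewrite RintegralD.
Qed.

Lemma integral_cutoff_divergence n :
  \int[mu3]_x (cutoff n x * divergence x) =
  - \int[mu3]_x (\sum_(i < 3) partial i (cutoff n) x * W i x).
Proof.
have Cc := @cutoff_Ck R n 1; have cc := Ck_continuous Cc.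
have sc := @cutoff_supported R n.
have cp i := Ck_continuous (Ck_partial i Cc).
have sp i := @supported_partial _ _ _ i sc.
transitivity (\int[mu3]_x (\sum_(i < 3) partial i (W i) x * cutoff n x)).
  by apply: eq_Rintegral => x _; rewrite mulrC /divergence mulr_suml.
rewrite Rintegral_sum3; last first.
  by move=> i; exact: (supported_mul_integrable (Ck_continuous (Ck_partial i (CW i))) cc sc).
transitivity (- \int[mu3]_x (\sum_(i < 3) W i x * partial i (cutoff n) x)).
  rewrite Rintegral_sum3; last first.
    by move=> i; exact: (supported_mul_integrable (Ck_continuous (CW i)) (cp i) (sp i)).
  rewrite -sumrN; apply: eq_bigr => i _.
  by rewrite (integration_by_parts_supported i (CW i) Cc sc) opprK.
by congr (- _); apply: eq_Rintegral => x _; apply: eq_bigr => i _; rewrite mulrC.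
Qed.

Lemma dominating_ge0 x : 0 <= K x.
Proof.
have : 0 <= (1 + \sum_(j < 3) `|coord j x|) * K x by exact: le_trans (WK ord0 x).
by rewrite pmulr_rge0// ltr_wpDr// sumr_ge0.
Qed.

(** After integration by parts the integrand is - grad(cutoff) . W. It tends to 0 pointwise, and the
    weight 1 + sum_j |x_j| in [WK] is absorbed by the decay of the cutoff gradient, leaving the
    dominating function 3 M K. *)
Lemma cvg_cutoff_divergence :
  \int[mu3]_x (cutoff n x * divergence x) @[n --> \oo] --> (0 : R).
Proof.
have [M M0 HM] := @partial_cutoff_bound R.
under eq_fun do rewrite integral_cutoff_divergence.
suff H : \int[mu3]_x (\sum_(i < 3) partial i (cutoff n) x * W i x) @[n --> \oo] --> (0 : R).
  by move/cvgN : H; rewrite oppr0.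
have E0 : \int[mu3]_x cst 0 x = 0 :> R by rewrite /Rintegral integral0.
rewrite -[X in _ --> X]E0.
apply: (@Rdominated_cvg _ (fun n x => \sum_(i < 3) partial i (cutoff n) x * W i x)
  (cst 0) (fun x => 3 * M * K x)).
- move=> n; apply: continuous_measurable_R3.
  apply: (@continuous_sum3 (fun i x => partial i (cutoff n) x * W i x)) => i.
  apply: continuous_mul; last exact: Ck_continuous (CW i).
  exact: Ck_continuous (Ck_partial i (cutoff_Ck n 1)).
- exact: measurable_cst.
- move=> x; suff : \sum_(i < 3) partial i (cutoff n) x * W i x @[n --> \oo] --> (\sum_(i < 3) 0 : R).
    by rewrite big1_eq.
  apply: cvg_big => [|i _]; first exact: add_continuous.
  rewrite -(mul0r (W i x)).
  apply: cvgM; last exact: cvg_cst.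
  apply/cvgr0Pnorm_le => e e0.
  have H : n.+1%:R^-1 * M @[n --> \oo] --> (0 * M : R).
    by apply: cvgM; [exact: (@cvg_harmonic R)|exact: cvg_cst].
  rewrite mul0r in H; move/cvgr0Pnorm_le/(_ _ e0) : H.
  apply: filterS => n; rewrite ger0_norm; last by rewrite mulr_ge0.
  by apply: le_trans; have [] := HM n i x.
- exact: integrable_scale.
- move=> n x; rewrite (le_trans (ler_norm_sum _ _ _))//.
  rewrite (le_trans (y := \sum_(i < 3) M * K x))//; last first.
    by rewrite sumr_const card_ord -[X in X <= _]mulr_natl mulrA.
  apply: ler_sum => i _; rewrite normrM.
  rewrite (le_trans (ler_wpM2l _ (WK i x)))// mulrA ler_wpM2r ?dominating_ge0//.
  by have [] := HM n i x.
Qed.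

Lemma integral_divergence0 : mu3.-integrable setT (EFin \o divergence) ->
  \int[mu3]_x divergence x = 0.
Proof.
move=> di.
have mdiv := continuous_measurable_R3 continuous_divergence.
have c0 := @cutoff0_gt0 R.
have H : \int[mu3]_x (cutoff n x * divergence x) @[n --> \oo] -->
    \int[mu3]_x (cutoff0 0 * divergence x).
  apply: (@Rdominated_cvg _ _ _ (fun x => `|divergence x|)).
  - move=> n; apply: measurable_funM => //.
    exact: continuous_measurable_R3 (Ck_continuous (cutoff_Ck n 0)).
  - by apply: measurable_funM => //; exact: measurable_cst.
  - by move=> x; apply: cvgM; [exact: cvg_cutoff|exact: cvg_cst].
  - exact: integrable_norm.
  - move=> n x; rewrite normrM ler_piMl//.
    by have /andP[a b] := cutoff_itv n x; rewrite ger0_norm.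
have H0 : \int[mu3]_x (cutoff0 0 * divergence x) = 0.
  exact: (cvg_unique (@Rhausdorff R) H cvg_cutoff_divergence).
move: H0; rewrite RintegralZl// => /eqP.
by rewrite mulf_eq0 (gt_eqF c0) => /eqP.
Qed.

(** The cutoff integrals of the divergence tend to 0 and those of [F2] converge, hence so do those
    of [F1]. Since [F1] is nonnegative, Fatou turns this into integrability. *)
Lemma divergence_integrable F1 F2 : continuous F1 -> continuous F2 ->
  (forall x, divergence x = F1 x + F2 x) -> (forall x, 0 <= F1 x) ->
  mu3.-integrable setT (EFin \o F2) -> mu3.-integrable setT (EFin \o F1).
Proof.
move=> cF1 cF2 dE F10 iF2.
have mF1 := continuous_measurable_R3 cF1; have mF2 := continuous_measurable_R3 cF2.
have mc n := continuous_measurable_R3 (Ck_continuous (@cutoff_Ck R n 0)).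
have c0 := @cutoff0_gt0 R.
have i1 n : mu3.-integrable setT (EFin \o (fun x => F1 x * cutoff n x)).
  exact: supported_mul_integrable cF1 (Ck_continuous (cutoff_Ck n 0)) (@cutoff_supported _ n).
have i2 n : mu3.-integrable setT (EFin \o (fun x => F2 x * cutoff n x)).
  exact: supported_mul_integrable cF2 (Ck_continuous (cutoff_Ck n 0)) (@cutoff_supported _ n).
have H2 : \int[mu3]_x (F2 x * cutoff n x) @[n --> \oo] --> \int[mu3]_x (F2 x * cutoff0 0).
  apply: (@Rdominated_cvg _ _ _ (fun x => `|F2 x|)).
  - by move=> n; apply: measurable_funM; [exact: mF2|exact: mc].
  - by apply: measurable_funM => //; exact: measurable_cst.
  - by move=> x; apply: cvgM; [exact: cvg_cst|exact: cvg_cutoff].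
  - exact: integrable_norm.
  - move=> n x; rewrite normrM ler_piMr//.
    by have /andP[a b] := cutoff_itv n x; rewrite ger0_norm.
have H1 : \int[mu3]_x (F1 x * cutoff n x) @[n --> \oo] -->
    0 - \int[mu3]_x (F2 x * cutoff0 0).
  have -> : (fun n => \int[mu3]_x (F1 x * cutoff n x)) =
      (fun n => \int[mu3]_x (cutoff n x * divergence x) - \int[mu3]_x (F2 x * cutoff n x)).
    apply/funext => n; apply/eqP; rewrite -subr_eq opprK -RintegralD//; apply/eqP.
    by apply: eq_Rintegral => x _; rewrite dE [RHS]mulrC mulrDl.
  by apply: cvgB; [exact: cvg_cutoff_divergence|exact: H2].
have P : mu3.-integrable setT (EFin \o (fun x => F1 x * cutoff0 0)).
  apply: (proj1 (@Rfatou _ (fun n x => F1 x * cutoff n x) _ _ _ _ _ _ i1 H1)).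
  - by move=> n; apply: measurable_funM; [exact: mF1|exact: mc].
  - by apply: measurable_funM => //; exact: measurable_cst.
  - by move=> n x; rewrite mulr_ge0//; have /andP[] := cutoff_itv n x.
  - by move=> x; apply: cvgM; [exact: cvg_cst|exact: cvg_cutoff].
have := integrable_scale (cutoff0 0)^-1 P.
by apply: eq_integrable => // x _; rewrite /= mulrC mulfK// gt_eqF.
Qed.

End DivergenceTheorem.

(** * Symmetry of second derivatives *)

Section MixedPartials.
Context {R : realType}.
Implicit Types f : R3 R -> R.

Lemma line_continuous f i (y : R3 R) : (forall x, derivable f x (std_basis i)) ->
  continuous (fun s : R => f (s *: std_basis i + y)).
Proof.
move=> df s; apply/differentiable_continuous/derivable1_diffP.
by have [] := is_derive_line (df (s *: std_basis i + y)).
Qed.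

Lemma MVT_line f i (y : R3 R) (h : R) : 0 < h -> (forall x, derivable f x (std_basis i)) ->
  exists2 c, 0 < c < h & f (h *: std_basis i + y) - f y =
    partial i f (c *: std_basis i + y) * h.
Proof.
move=> h0 df.
have [c] := @MVT R (fun s => f (s *: std_basis i + y)) _ 0 h h0
  (fun s _ => is_derive_line (df (s *: std_basis i + y)))
  (continuous_subspaceT (line_continuous (y := y) df)).
rewrite in_itv/= => ch E; exists c => //.
by move: E; rewrite scale0r add0r subr0.
Qed.

(** The mean value theorem is used twice on the second difference: in direction [i] for the
    increment of [f] along [j], then in direction [j] for [partial i f]. *)
Lemma mixed_increment f i j (x : R3 R) (h : R) : Ck 2 f -> 0 < h ->
  exists c d, [/\ 0 < c < h, 0 < d < h &
    f (h *: std_basis i + (h *: std_basis j + x)) - f (h *: std_basis j + x)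
      - (f (h *: std_basis i + x) - f x)
    = partial j (partial i f) (d *: std_basis j + (c *: std_basis i + x)) * h * h].
Proof.
move=> Cf h0.
have Df y := Ck_derive i y Cf.
have d1 k y := is_derive_derivable (Ck_derive k y (Ck_partial i Cf)).
pose g y := f (h *: std_basis j + y) - f y.
have dsh y : is_derive y (std_basis i) (fun y => f (h *: std_basis j + y))
    (partial i f (h *: std_basis j + y)).
  apply: is_derive_of_line.
  have -> : (fun s : R => f (h *: std_basis j + (s *: std_basis i + y))) =
      (fun s => f (s *: std_basis i + (h *: std_basis j + y))).
    by apply/funext => s; rewrite addrCA.
  have E : (0 : R) *: std_basis i + (h *: std_basis j + y) = h *: std_basis j + y.
    by rewrite scale0r add0r.
  rewrite -[in partial i f _]E; apply: (is_derive_line (f := f)).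
  exact: is_derive_derivable (Df _).
have Dg y := is_derive_sub (dsh y) (Df y).
have [c ch E] := @MVT_line g i x h h0 (fun y => is_derive_derivable (Dg y)).
have [d dh E2] := @MVT_line (partial i f) j (c *: std_basis i + x) h h0 (d1 j).
exists c, d; split => //.
rewrite -E2 -(partial_eq (Dg (c *: std_basis i + x))) -E /g.
by rewrite (addrCA (h *: std_basis j)); ring.
Qed.

(** The second difference is symmetric in [i] and [j], so the two mixed derivatives take a common
    value at two points near [x]; continuity brings both back to [x]. *)
Lemma partialC f i j (x : R3 R) : Ck 2 f ->
  partial i (partial j f) x = partial j (partial i f) x.
Proof.
move=> Cf; apply/eqP; rewrite -subr_eq0 -normr_le0; apply/ler_addgt0Pr => e e0.
rewrite add0r.
have near_val k l : exists2 r : R, 0 < r & forall y, ball x r y ->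
    `|partial k (partial l f) x - partial k (partial l f) y| < e / 2.
  have cc : continuous (partial k (partial l f)).
    exact: Ck_continuous (Ck_partial k (Ck_partial l Cf)).
  have /cvgrPdist_lt := cc x.
  move=> /(_ (e / 2)); rewrite divr_gt0// => /(_ isT) /nbhs_ballP[r /= r0 H].
  by exists r.
have [r1 r10 H1] := near_val i j; have [r2 r20 H2] := near_val j i.
(* The halving covers i = j, where both displacements add up in the same coordinate. *)
pose h := Num.min r1 r2 / 2.
have h0 : 0 < h by rewrite /h divr_gt0// lt_min r10 r20.
have hball k l (c d : R) : 0 < c < h -> 0 < d < h ->
    ball x (Num.min r1 r2) (d *: std_basis k + (c *: std_basis l + x)).
  move=> /andP[c0 ch] /andP[d0 dh].
  have hh : h + h = Num.min r1 r2 by rewrite /h -splitr.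
  have B (a a' b : R) : 0 <= a <= 1 -> 0 <= a' <= 1 ->
      ball b (Num.min r1 r2) (d * a + (c * a' + b)).
    move=> /andP[a0 a1] /andP[a'0 a'1]; rewrite -ball_normE /ball_/=.
    rewrite -hh ltr_norml; apply/andP; split; nra.
  have z1 : 0 <= (0 : R) <= 1 by rewrite lexx ler01.
  have o1 : 0 <= (1 : R) <= 1 by rewrite lexx ler01.
  rewrite !lineE; split; [split|]; rewrite /=; apply: B;
    by rewrite /std_basis; case: (val _) => [|[|_]].
have [c [d [ch dh E]]] := mixed_increment i j x Cf h0.
have [c' [d' [ch' dh' E']]] := mixed_increment j i x Cf h0.
have EE : partial j (partial i f) (d *: std_basis j + (c *: std_basis i + x)) =
    partial i (partial j f) (d' *: std_basis i + (c' *: std_basis j + x)).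
  apply: (mulIf (lt0r_neq0 h0)); apply: (mulIf (lt0r_neq0 h0)).
  apply: etrans (esym E) _; apply: etrans E'.
  have gen (a b c0 d0 : R) : a - b - (c0 - d0) = a - c0 - (b - d0) by ring.
  by rewrite gen; congr (f _ - _ - _); exact: addrCA.
have b1 := H1 _ (le_ball (le_trans (lexx _) _) (hball i j c' d' ch' dh')).
have b2 := H2 _ (le_ball (le_trans (lexx _) _) (hball j i c d ch dh)).
have {}b1 := b1 (ltac:(by rewrite ge_min lexx)).
have {}b2 := b2 (ltac:(by rewrite ge_min lexx orbT)).
rewrite EE in b2.
move: b1 b2; move: (partial i (partial j f) x) (partial j (partial i f) x).
move: (partial i (partial j f) _) => m a b b1 b2.
rewrite (_ : a - b = (a - m) - (b - m)); last by ring.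
by have := ler_normB (a - m) (b - m); clear -b1 b2; lra.
Qed.

End MixedPartials.

(** * Reduction to constant coefficients *)

Section PeriodicConstant.
Context {R : realType}.
Implicit Types f : R3 R -> R.

Lemma partial_periodic f i (k l m : int) x : Z3_periodic f ->
  partial i f (x + (k%:~R, l%:~R, m%:~R)) = partial i f x.
Proof.
move=> pf; rewrite /partial /derive; set K := (k%:~R, l%:~R, m%:~R).
have -> : (fun h : R => h^-1 *: ((f \o shift (x + K)) (h *: std_basis i) - f (x + K))) =
    (fun h : R => h^-1 *: ((f \o shift x) (h *: std_basis i) - f x)).
  by apply/funext => h /=; rewrite addrA !pf.
by [].
Qed.

Lemma affine_int_ge0 (a d : R) : (forall n : int, 0 <= a + n%:~R * d) -> d = 0.
Proof.
move=> H; apply/eqP/negPn/negP => d0.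
have nd0 : 0 < `|d| by rewrite normr_gt0.
pose n := (Num.truncn (`|a| / `|d|)).+1.
have an : `|a| < n%:R * `|d|.
  rewrite -ltr_pdivrMr//.
  by have /andP[] := truncn_itv (divr_ge0 (normr_ge0 a) (ltW nd0)).
have h1 := H n; have h2 := H (- (n : int)).
rewrite mulrNz in h2; have := ler_norm a.
have [dp|dn] := leP 0 d.
  rewrite (ger0_norm dp) in an; move: h2; rewrite -pmulrn => h2; nra.
rewrite (ltr0_norm dn) in an; move: h1; rewrite -pmulrn => h1; nra.
Qed.

Lemma grad_dot_id_translate f (k l m : int) x : Z3_periodic f ->
  grad_dot_id f (x + (k%:~R, l%:~R, m%:~R)) = grad_dot_id f x +
    \sum_(i < 3) partial i f x * coord i (k%:~R, l%:~R, m%:~R).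
Proof.
move=> pf; rewrite /grad_dot_id -big_split; apply: eq_bigr => i _ /=.
rewrite partial_periodic// -mulrDr; congr (_ * _).
by rewrite /coord; case: (val i) => [|[|_]].
Qed.

(* Translating [x] by integer vectors changes [<grad f(x), x>] by an arbitrary
   integer combination of the partial derivatives. *)
Lemma periodic_partial0 f (s : R) : s != 0 -> Z3_periodic f ->
  (forall x, 0 <= s * grad_dot_id f x) -> forall i x, partial i f x = 0.
Proof.
move=> s0 pf H i x; apply: (mulfI s0); rewrite mulr0.
apply: (@affine_int_ge0 (s * grad_dot_id f x)) => n.
pose K (j : 'I_3) : int := if j == i then n else 0.
have := H (x + ((K (@Ordinal 3 0 isT))%:~R, (K (@Ordinal 3 1 isT))%:~R, (K (@Ordinal 3 2 isT))%:~R)).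
rewrite grad_dot_id_translate// mulrDr (bigD1 i)//= big1 ?addr0.
  suff -> : coord i ((K (@Ordinal 3 0 isT))%:~R, (K (@Ordinal 3 1 isT))%:~R, (K (@Ordinal 3 2 isT))%:~R) = n%:~R :> R.
    by rewrite [s * (_ * _)]mulrA [s * _ * n%:~R]mulrC.
  by rewrite /coord /K; clear K; case: i => [[|[|[|]]]].
move=> j ji; rewrite [coord j _](_ : _ = 0) ?mulr0//.
by move: ji; rewrite /coord /K; clear K; case: i => [[|[|[|]]]]//; case: j => [[|[|[|]]]].
Qed.

Lemma partial0_cst f : Ck 1 f -> (forall i x, partial i f x = 0) -> forall x, f x = f 0.
Proof.
move=> Cf f0 x.
have L i y (t : R) : f (t *: std_basis i + y) = f y.
  rewrite -[in RHS](add0r y) -[in RHS](scale0r (std_basis i)).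
  apply: (@is_derive_0_is_cst R (fun t => f (t *: std_basis i + y))) => s.
  have := is_derive_line (is_derive_derivable (Ck_derive i (s *: std_basis i + y) Cf)).
  by rewrite -/(partial i f _) f0.
have -> : x = x.1.1 *: std_basis (@Ordinal 3 0 isT) +
    (x.1.2 *: std_basis (@Ordinal 3 1 isT) + (x.2 *: std_basis (@Ordinal 3 2 isT) + 0)).
  by case: x => -[a b] c; rewrite !lineE/= !(mulr0, mulr1, addr0, add0r).
by rewrite !L.
Qed.

(** [s] carries the sign: 1 for the potentials, -1 for [lam]. *)
Lemma periodic_cst f (s : R) : s != 0 -> Ck 1 f -> Z3_periodic f ->
  (forall x, 0 <= s * grad_dot_id f x) -> forall x, f x = f 0.
Proof. by move=> s0 Cf pf H; apply: partial0_cst => //; exact: periodic_partial0 pf H. Qed.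

End PeriodicConstant.

Section KirchhoffCoefficient.
Context {R : realType}.
Implicit Types alpha beta : R -> R.

(** A bound on alpha'(s) s says nothing at s = 0; there the sign comes from the quotients alpha(h)/h
    with h > 0. *)
Lemma derive_Rplus0_ge0 alpha : alpha 0 = 0 -> (forall s, 0 <= s -> 0 <= alpha s) ->
  derivable_Rplus alpha 0 -> 0 <= derive_Rplus alpha 0.
Proof.
move=> a0 age0 da.
have H : (fun h : R => h^-1 * (alpha (0 + h) - alpha 0)) @ 0^'+ --> derive_Rplus alpha 0.
  apply: cvg_trans da; apply: cvg_app => A hA.
  have : nbhs (0 : R) (fun h => h != 0 -> 0 <= 0 + h -> A h) by exact: hA.
  suff P h : (h != 0 -> 0 <= 0 + h -> A h) -> 0 < h -> A h by exact: filterS P.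
  by move=> + h0; apply; [rewrite gt_eqF|rewrite add0r ltW].
rewrite -(cvg_lim (@Rhausdorff R) H); apply: limr_ge; first by apply/cvg_ex; eexists; exact: H.
near=> h.
have h0 : 0 < h by near: h; exact: nbhs_right_gt.
by rewrite a0 subr0 add0r mulr_ge0// ?invr_ge0 ?age0// ltW.
Unshelve. all: by end_near.
Qed.

(** At (0,0) the last inequality of [cond_M3] forces alpha(0) = beta(0) = 0, both being nonnegative.
    Setting one argument to 0 then separates the functions: 0 <= alpha(s) <= alpha'(s) s, and
    likewise for beta. *)
Lemma derive_Rplus_ge0 alpha beta : C2_Rplus alpha -> C2_Rplus beta ->
  cond_M3 alpha beta -> forall s, 0 <= s ->
  0 <= derive_Rplus alpha s /\ 0 <= derive_Rplus beta s.
Proof.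
move=> [a0 da _ _] [b0 db _ _] [c1 [c2 [_ _ M3]]] s s0.
have [_ _ _] := M3 0 0 (lexx _) (lexx _); rewrite !mulr0 addr0 => h0.
have az : alpha 0 = 0 by have := a0 0 (lexx _); have := b0 0 (lexx _); lra.
have bz : beta 0 = 0 by have := a0 0 (lexx _); have := b0 0 (lexx _); lra.
have [->|sn0] := eqVneq s 0.
  by split; apply: derive_Rplus0_ge0 => //; [exact: da|exact: db].
have sp : 0 < s by rewrite lt_neqAle eq_sym sn0.
have [_ _ _ h1] := M3 s 0 s0 (lexx _); have [_ _ _ h2] := M3 0 s (lexx _) s0.
have := a0 s s0; have := b0 s s0; rewrite mulr0 in h1 h2.
by move=> h3 h4; split; rewrite -(pmulr_lge0 _ sp); lra.
Qed.

End KirchhoffCoefficient.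

(** * Pohozaev identity *)

Section PohozaevAlgebra.
Context {R : realType}.

(** [d] stands for the gradient, [D] for the Hessian, [y] for the point. Symmetry of [D] cancels the
    terms d_i y_j D_ij, and |d|^2 receives 1 + 1/2 - 3/2 = 0, which is where dimension 3 enters. *)
Lemma pohozaev_algebra (d y : 'I_3 -> R) (D : 'I_3 -> 'I_3 -> R) (w : R) :
  (forall i j, D i j = D j i) ->
  \sum_(i < 3) (D i i * (\sum_(j < 3) y j * d j + 2^-1 * w)
    + d i * (d i + \sum_(j < 3) y j * D i j + 2^-1 * d i)
    - 2^-1 * (\sum_(j < 3) d j ^+ 2 + y i * \sum_(j < 3) 2 * d j * D i j))
  = (\sum_(i < 3) D i i) * (\sum_(j < 3) y j * d j + 2^-1 * w).
Proof.
move=> DC; rewrite !big_ord_recl !big_ord0.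
set i0 := (ord0 : 'I_3); set i1 := (lift ord0 ord0 : 'I_3); set i2 := (lift ord0 (lift ord0 ord0) : 'I_3).
rewrite (DC i1 i0) (DC i2 i0) (DC i2 i1).
move: (d i0) (d i1) (d i2) (y i0) (y i1) (y i2) => d0 d1 d2 y0 y1 y2.
move: (D i0 i0) (D i0 i1) (D i0 i2) (D i1 i1) (D i1 i2) (D i2 i2) => a b c e f g.
by clear; field.
Qed.

End PohozaevAlgebra.

Section PohozaevField.
Context {R : realType}.
Implicit Types w : R3 R -> R.

Lemma is_derive_sum3 {V : normedModType R} (f : 'I_3 -> V -> R) (x v : V) (d : 'I_3 -> R) :
  (forall j, is_derive x v (f j) (d j)) ->
  is_derive x v (fun y => \sum_(j < 3) f j y) (\sum_(j < 3) d j).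
Proof.
move=> df.
have -> : (fun y => \sum_(j < 3) f j y) = \sum_(j < 3) f j.
  by apply/funext => y; rewrite fct_sumE.
exact: is_derive_sum.
Qed.

Lemma Ck_coord k i : Ck k (coord i : R3 R -> R).
Proof.
case: k => [|k]; first exact: continuous_coord.
apply: (CkS _ (fun j x => is_derive_coord j i x)) => [|j]; first exact: continuous_coord.
exact: Ck_cst.
Qed.

Lemma Ck_sum3 k (f : 'I_3 -> R3 R -> R) : (forall j, Ck k (f j)) ->
  Ck k (fun x => \sum_(j < 3) f j x).
Proof.
move=> Cf; under [X in Ck k X]funext => x do rewrite !big_ord_recl big_ord0.
by do 3?[apply: Ck_add => //]; exact: Ck_cst.
Qed.

Lemma Ck_pow k n (f : R3 R -> R) : Ck k f -> Ck k (fun x => f x ^+ n).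
Proof.
move=> Cf; elim: n => [|n IH]; first exact: Ck_cst.
by under [X in Ck k X]funext => x do rewrite exprS; exact: Ck_mul.
Qed.

Definition grad_sqr w (x : R3 R) : R := \sum_(j < 3) partial j w x ^+ 2.

Definition radial w (x : R3 R) : R := \sum_(j < 3) coord j x * partial j w x.

(* The coefficient 1/2 is (N - 2)/2 for N = 3. *)
Definition pohozaev_field w (i : 'I_3) (x : R3 R) : R :=
  partial i w x * (radial w x + 2^-1 * w x) - 2^-1 * (coord i x * grad_sqr w x).

Lemma Ck_grad_sqr k w : Ck k.+1 w -> Ck k (grad_sqr w).
Proof. by move=> Cw; apply: Ck_sum3 => j; apply: Ck_pow; exact: Ck_partial. Qed.

Lemma Ck_radial k w : Ck k.+1 w -> Ck k (radial w).
Proof.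
by move=> Cw; apply: Ck_sum3 => j; apply: Ck_mul; [exact: Ck_coord|exact: Ck_partial].
Qed.

Lemma Ck_scale k (c : R) w : Ck k w -> Ck k (fun x => c * w x).
Proof. by move=> Cw; apply: Ck_mul => //; exact: Ck_cst. Qed.

Lemma Ck_sub k f g : Ck k f -> Ck k g -> Ck k (fun x : R3 R => f x - g x : R).
Proof.
move=> Cf Cg; under [X in Ck k X]funext => x do rewrite -[g x]mul1r -mulNr.
by apply: Ck_add => //; exact: Ck_scale.
Qed.

Lemma Ck_pohozaev_field w i : Ck 2 w -> Ck 1 (pohozaev_field w i).
Proof.
move=> Cw; apply: Ck_sub.
  apply: Ck_mul; first exact: Ck_partial.
  by apply: Ck_add; [exact: Ck_radial|apply: Ck_scale; exact: Ck_pred].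
by apply: Ck_scale; apply: Ck_mul; [exact: Ck_coord|exact: Ck_grad_sqr].
Qed.

Lemma is_derive_grad_sqr w i x : Ck 2 w ->
  is_derive x (std_basis i) (grad_sqr w)
    (\sum_(j < 3) 2 * partial j w x * partial i (partial j w) x).
Proof.
move=> Cw; apply: is_derive_sum3 => j.
have := is_derive_pow 1 (Ck_derive i x (Ck_partial j Cw)).
by rewrite expr1.
Qed.

Lemma is_derive_radial w i x : Ck 2 w ->
  is_derive x (std_basis i) (radial w)
    (partial i w x + \sum_(j < 3) coord j x * partial i (partial j w) x).
Proof.
move=> Cw.
have H := is_derive_sum3 (fun j => is_derive_mul (is_derive_coord i j x)
  (Ck_derive i x (Ck_partial j Cw))).
apply: (is_derive_eq H); rewrite big_split/=; congr (_ + _).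
rewrite (bigD1 i)//= eqxx mul1r big1 ?addr0// => j ji.
by rewrite eq_sym (negbTE ji) mul0r.
Qed.

Lemma partial_pohozaev_field w i x : Ck 2 w ->
  partial i (pohozaev_field w i) x =
  partial i (partial i w) x * (radial w x + 2^-1 * w x)
  + partial i w x * (partial i w x + \sum_(j < 3) coord j x * partial i (partial j w) x
     + 2^-1 * partial i w x)
  - 2^-1 * (grad_sqr w x + coord i x *
     \sum_(j < 3) 2 * partial j w x * partial i (partial j w) x).
Proof.
move=> Cw; apply: partial_eq; apply: is_derive_sub.
  apply: is_derive_mul; first exact: Ck_derive (Ck_partial i Cw).
  apply: is_derive_add; first exact: is_derive_radial.
  by apply: is_derive_scale; exact: Ck_derive Cw.
apply: is_derive_scale.
have := is_derive_mul (is_derive_coord i i x) (is_derive_grad_sqr i x Cw).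
by rewrite eqxx mul1r.
Qed.

Lemma divergence_pohozaev_field w x : Ck 2 w ->
  divergence (pohozaev_field w) x = laplacian w x * (radial w x + 2^-1 * w x).
Proof.
move=> Cw.
rewrite -(@pohozaev_algebra _ (fun j => partial j w x) (fun j => coord j x)
  (fun i j => partial i (partial j w) x)); last by move=> i j; exact: partialC.
by apply: eq_bigr => i _; rewrite partial_pohozaev_field.
Qed.

Lemma partial_le_grad_sqr w i j x :
  `|partial i w x| * `|partial j w x| <= grad_sqr w x.
Proof.
have H k : `|partial k w x| ^+ 2 <= grad_sqr w x.
  rewrite real_normK ?num_real// /grad_sqr (bigD1 k)//= lerDl.
  by apply: sumr_ge0 => ? _; exact: sqr_ge0.
have := H i; have := H j; move: `|partial i w x| `|partial j w x| (grad_sqr w x) => a b G.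
have := sqr_ge0 (a - b); clear; nra.
Qed.

Lemma grad_sqr_ge0 w x : 0 <= grad_sqr w x.
Proof. by apply: sumr_ge0 => j _; exact: sqr_ge0. Qed.

Lemma coord_le_sum i (x : R3 R) : `|coord i x| <= \sum_(j < 3) `|coord j x|.
Proof. by rewrite (bigD1 i)//= lerDl sumr_ge0. Qed.

Lemma pohozaev_field_bound w i x :
  `|pohozaev_field w i x| <=
  (1 + \sum_(j < 3) `|coord j x|) * (2 * (grad_sqr w x + w x ^+ 2)).
Proof.
set s := \sum_(j < 3) _; have s0 : 0 <= s by exact: sumr_ge0.
have rb : `|partial i w x * radial w x| <= s * grad_sqr w x.
  rewrite normrM (le_trans (ler_wpM2l (normr_ge0 _) (ler_norm_sum _ _ _)))//.
  rewrite mulr_sumr mulr_suml; apply: ler_sum => j _.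
  by rewrite normrM mulrCA ler_wpM2l// partial_le_grad_sqr.
have wb : `|partial i w x * w x| <= grad_sqr w x + w x ^+ 2.
  rewrite normrM; have := partial_le_grad_sqr w i i x; rewrite -(real_normK (num_real (w x))).
  move: `|partial i w x| `|w x| (grad_sqr w x) => a b G.
  have := sqr_ge0 (a - b); clear; nra.
have cb : `|coord i x * grad_sqr w x| <= s * grad_sqr w x.
  by rewrite normrM (ger0_norm (grad_sqr_ge0 w x)) ler_wpM2r ?grad_sqr_ge0// coord_le_sum.
have -> : pohozaev_field w i x = partial i w x * radial w x
   + 2^-1 * (partial i w x * w x) - 2^-1 * (coord i x * grad_sqr w x).
  rewrite /pohozaev_field mulrDr; congr (_ + _ - _); exact: mulrCA.
have G0 := grad_sqr_ge0 w x; have w0 := sqr_ge0 (w x).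
move: rb wb cb G0 w0; rewrite !ler_norml.
move: (partial i w x * radial w x) (partial i w x * w x) (coord i x * grad_sqr w x) (grad_sqr w x) (w x ^+ 2).
move=> a b c G w2; move: s s0; clear=> s s0.
move=> /andP[? ?] /andP[? ?] /andP[? ?] ? ?.
have ? : 0 <= s * w2 by exact: mulr_ge0.
have ? : 0 <= s * G by exact: mulr_ge0.
apply/andP; split; lra.
Qed.

End PohozaevField.

(** * Integrability of the lower-order and critical terms *)

Section Energy.
Context {R : realType}.
Implicit Types w z : R3 R -> R.

(** Otherwise [f] would vanish almost everywhere, and a box of volume 8 would lie in a null set. *)
Lemma Rintegral_gt0 f : mu3.-integrable setT (EFin \o f) ->
  (forall x : R3 R, 0 < f x) -> (0 : R) < \int[mu3]_x f x.
Proof.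
move=> fi f0; rewrite lt_neqAle eq_sym; apply/andP; split; last first.
  by apply: Rintegral_ge0 => x _; exact: ltW.
apply/eqP => If.
have mf : measurable_fun [set: mR3 R] (EFin \o f) by case/integrableP : fi.
have E : (\int[mu3]_x `|(EFin \o f) x| = 0)%E.
  have -> : (\int[mu3]_x `|(EFin \o f) x| = \int[mu3]_x (f x)%:E)%E.
    by apply: eq_integral => x _ /=; rewrite ger0_norm// ltW.
  rewrite -(fineK (integrable_fin_num measurableT fi)).
  exact: (congr1 EFin If).
have := (ae_eq_integral_abs mu3 measurableT mf).1 E.
move=> [N [mN N0 sub]].
have : (mu3 (box 1) <= mu3 N)%E.
  apply: le_measure; rewrite ?inE//; first exact: measurable_box.
  move=> x _; apply: sub => /= /(_ I) [h].
  by have := f0 x; rewrite h ltxx.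
by rewrite N0 mu3_box// lee_fin leNgt exprn_gt0// mulr_gt0.
Qed.

Lemma integrable_sum3 (f : 'I_3 -> R3 R -> R) :
  (forall i, mu3.-integrable setT (EFin \o f i)) ->
  mu3.-integrable setT (EFin \o (fun x => \sum_(i < 3) f i x)).
Proof.
move=> fi.
have := integrable_add (fi ord0) (integrable_add (fi (lift ord0 ord0))
  (fi (lift ord0 (lift ord0 ord0)))).
by apply: eq_integrable => // x _; rewrite /= !big_ord_recl big_ord0 addr0.
Qed.

Lemma integrable_sub f g : mu3.-integrable setT (EFin \o f) ->
  mu3.-integrable setT (EFin \o g) ->
  mu3.-integrable setT (EFin \o (fun x : R3 R => f x - g x : R)).
Proof.
move=> fi gi; have := integrable_add fi (integrable_scale (-1) gi).
by apply: eq_integrable => // x _; rewrite /= mulN1r.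
Qed.

Lemma mul_integrable w z : continuous w -> continuous z ->
  mu3.-integrable setT (EFin \o (fun x => w x ^+ 2)) ->
  mu3.-integrable setT (EFin \o (fun x => z x ^+ 2)) ->
  mu3.-integrable setT (EFin \o (fun x => w x * z x)).
Proof.
move=> cw cz iw iz.
apply: dominated_integrable (integrable_add iw iz) _.
  exact: continuous_measurable_R3 (continuous_mul cw cz).
move=> x; move: (w x) (z x) => a b; rewrite ler_norml.
have := sqr_ge0 (a - b); have := sqr_ge0 (a + b); clear=> h1 h2.
by apply/andP; split; nra.
Qed.

Lemma divergence_mul_grad (c : R) w x : Ck 2 w ->
  divergence (fun i y => c * (w y * partial i w y)) x =
  c * (grad_sqr w x + w x * laplacian w x).
Proof.
move=> Cw; rewrite /divergence /grad_sqr /laplacian mulr_sumr -big_split mulr_sumr /=.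
apply: eq_bigr => i _; apply: partial_eq.
apply: (is_derive_eq (is_derive_scale c (is_derive_mul
  (Ck_derive i x (Ck_pred Cw)) (Ck_derive i x (Ck_partial i Cw))))).
by rewrite expr2.
Qed.

(** By the equation, - A w grad w has divergence m w^6 - A |grad w|^2 - A c w^2 + l w z, where all
    terms after the first are integrable. The factor [m] stays in the conclusion because it may be
    0. *)
Lemma sixth_power_integrable (A c m l : R) w z : 0 <= m -> Ck 2 w -> Ck 2 z ->
  (forall x, 0 < w x) ->
  (forall x, A * (- laplacian w x + c * w x) = m * w x ^+ 5 + l * z x) ->
  mu3.-integrable setT (EFin \o (fun x => w x ^+ 2)) ->
  mu3.-integrable setT (EFin \o (fun x => z x ^+ 2)) ->
  mu3.-integrable setT (EFin \o grad_sqr w) ->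
  mu3.-integrable setT (EFin \o (fun x => m * w x ^+ 6)).
Proof.
move=> m0 Cw Cz wp eqw iw iz iG.
pose W i y := - A * (w y * partial i w y).
pose K y := `|A| * (grad_sqr w y + w y ^+ 2).
have CW i : Ck 1 (W i).
  by apply: Ck_scale; apply: Ck_mul; [exact: Ck_pred|exact: Ck_partial].
have iK : mu3.-integrable setT (EFin \o K).
  by apply: integrable_scale; exact: integrable_add.
have WK i x : `|W i x| <= (1 + \sum_(j < 3) `|coord j x|) * K x.
  have K0 : 0 <= K x by rewrite mulr_ge0// addr_ge0 ?grad_sqr_ge0 ?sqr_ge0.
  rewrite mulrDl mul1r; apply: (@le_trans _ _ (K x)); last first.
    by rewrite lerDl mulr_ge0// sumr_ge0.
  rewrite /W /K !normrM normrN ler_wpM2l//.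
  have := partial_le_grad_sqr w i i x; rewrite -(real_normK (num_real (w x))).
  move: `|partial i w x| `|w x| (grad_sqr w x) => a b G; clear.
  have := sqr_ge0 (a - b); have := sqr_ge0 (a + b); nra.
have cw := Ck_continuous Cw; have cz := Ck_continuous Cz.
apply: (@divergence_integrable _ W K CW iK WK _
  (fun x => (- A * grad_sqr w x + (- A * c) * w x ^+ 2) + l * (w x * z x))).
- exact: Ck_continuous (Ck_scale m (Ck_pow 6 Cw)).
- have Ci : Ck 1 (fun x => (- A * grad_sqr w x + (- A * c) * w x ^+ 2) + l * (w x * z x)).
    apply: Ck_add; last by apply: Ck_scale; apply: Ck_mul; exact: Ck_pred.
    apply: Ck_add; first by apply: Ck_scale; exact: Ck_grad_sqr.
    by apply: Ck_scale; apply: Ck_pow; exact: Ck_pred.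
  exact: Ck_continuous Ci.
- move=> x; rewrite divergence_mul_grad//; have := eqw x.
  move: (grad_sqr w x) (laplacian w x) (w x) (z x) => G L a b; clear=> E.
  have -> : m * a ^+ 6 = (m * a ^+ 5 + l * b - l * b) * a by ring.
  rewrite -E; ring.
- by move=> x; rewrite mulr_ge0// exprn_ge0// ltW.
- apply: integrable_add; last by apply: integrable_scale; exact: mul_integrable.
  by apply: integrable_add; exact: integrable_scale.
Qed.

End Energy.

(** * The combined flux of the system *)

Section SystemAlgebra.
Context {R : realFieldType}.
Variables A B c1 c2 m l Lu Lv a b p q : R.

Lemma flux_sum (f g y d e : 'I_3 -> R) (H : R) :
  \sum_(i < 3) (A * f i + B * g i + (H + y i * (- A * Lu * d i - B * Lv * e i)))
  = A * (\sum_(i < 3) f i) + B * (\sum_(i < 3) g i)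
    + (3 * H - A * Lu * (\sum_(i < 3) y i * d i) - B * Lv * (\sum_(i < 3) y i * e i)).
Proof. by rewrite !big_ord_recl !big_ord0; ring. Qed.

Hypotheses (E1 : A * (- Lu + c1 * a) = m * a ^+ 5 + l * b)
  (E2 : B * (- Lv + c2 * b) = 1 * b ^+ 5 + l * a).

(** [a], [b] are the values of u, v and [p], [q] their derivatives in one direction. The left side
    is the chain rule for the potential exactly as [is_derive_pow] produces it, with exponents left
    unsimplified. *)
Lemma potential_algebra :
  - (2^-1 * A * c1) * (2%:R * a ^+ 1 * p) + - (2^-1 * B * c2) * (2%:R * b ^+ 1 * q) +
  (6^-1 * (m * (6%:R * a ^+ 5 * p)) + 6^-1 * (1 * (6%:R * b ^+ 5 * q))) +
  l * (p * b + a * q) = - A * Lu * p - B * Lv * q.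
Proof.
have -> : - A * Lu * p = (m * a ^+ 5 + l * b - A * c1 * a) * p by rewrite -E1; ring.
have -> : B * Lv * q = (B * c2 * b - (1 * b ^+ 5 + l * a)) * q by rewrite -E2; ring.
by field.
Qed.

(** Here [p], [q] are the radial derivatives. They cancel, and so do the sixth powers: 3/6 from the
    potential against 1/2 from the terms [2^-1 * a] and [2^-1 * b]. *)
Lemma flux_algebra :
  A * (Lu * (p + 2^-1 * a)) + B * (Lv * (q + 2^-1 * b)) +
  (3 * (- (2^-1 * A * c1) * a ^+ 2 + - (2^-1 * B * c2) * b ^+ 2
     + (6^-1 * (m * a ^+ 6) + 6^-1 * (1 * b ^+ 6)) + l * (a * b))
   - A * Lu * p - B * Lv * q)
  = - (A * c1 * a ^+ 2 + B * c2 * b ^+ 2 - 2 * l * (a * b)).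
Proof.
have -> : A * (Lu * (p + 2^-1 * a)) = A * Lu * p + 2^-1 * (A * c1 * a - (m * a ^+ 5 + l * b)) * a.
  by rewrite -E1; ring.
have -> : B * (Lv * (q + 2^-1 * b)) = B * Lv * q + 2^-1 * (B * c2 * b - (1 * b ^+ 5 + l * a)) * b.
  by rewrite -E2; ring.
by field.
Qed.

End SystemAlgebra.

Section Nonexistence.
Context {R : realType}.
Variables (A B c1 c2 m l : R) (u v : R3 R -> R).
Hypotheses (Cu : Ck 2 u) (Cv : Ck 2 v).
Hypotheses (up : forall x, 0 < u x) (vp : forall x, 0 < v x).
Hypothesis m0 : 0 <= m.
Hypothesis equ : forall x,
  A * (- laplacian u x + c1 * u x) = m * u x ^+ 5 + l * v x.
Hypothesis eqv : forall x,
  B * (- laplacian v x + c2 * v x) = 1 * v x ^+ 5 + l * u x.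
Hypotheses (iu : mu3.-integrable setT (EFin \o (fun x => u x ^+ 2)))
  (iv : mu3.-integrable setT (EFin \o (fun x => v x ^+ 2))).
Hypotheses (igu : mu3.-integrable setT (EFin \o grad_sqr u))
  (igv : mu3.-integrable setT (EFin \o grad_sqr v)).

(** On a solution its gradient is - A (Delta u) grad u - B (Delta v) grad v, so x times it removes
    the radial terms from the divergence of the Pohozaev fields. The factor [1] mirrors [m], so that
    both equations have one form. *)
Definition system_potential (x : R3 R) : R :=
  - (2^-1 * A * c1) * u x ^+ 2 + - (2^-1 * B * c2) * v x ^+ 2
  + (6^-1 * (m * u x ^+ 6) + 6^-1 * (1 * v x ^+ 6)) + l * (u x * v x).

Lemma Ck_potential : Ck 2 system_potential.
Proof.
apply: Ck_add; last by apply: Ck_scale; exact: Ck_mul.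
apply: Ck_add; first by apply: Ck_add; apply: Ck_scale; exact: Ck_pow.
by apply: Ck_add; do 2!apply: Ck_scale; exact: Ck_pow.
Qed.

Lemma potential_integrable : mu3.-integrable setT (EFin \o system_potential).
Proof.
have i6u := sixth_power_integrable m0 Cu Cv up equ iu iv igu.
have i6v := sixth_power_integrable ler01 Cv Cu vp eqv iv iu igv.
apply: integrable_add.
  apply: integrable_add; first by apply: integrable_add; exact: integrable_scale.
  by apply: integrable_add; exact: integrable_scale.
apply: integrable_scale.
exact: mul_integrable (Ck_continuous Cu) (Ck_continuous Cv) iu iv.
Qed.

Lemma is_derive_potential i x :
  is_derive x (std_basis i) system_potential
   (- A * laplacian u x * partial i u x - B * laplacian v x * partial i v x).
Proof.
have du := Ck_derive i x Cu; have dv := Ck_derive i x Cv.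
have H : is_derive x (std_basis i) system_potential _ :=
  is_derive_add (is_derive_add
   (is_derive_add (is_derive_scale (- (2^-1 * A * c1)) (is_derive_pow 1 du))
     (is_derive_scale (- (2^-1 * B * c2)) (is_derive_pow 1 dv)))
   (is_derive_add (is_derive_scale 6^-1 (is_derive_scale m (is_derive_pow 5 du)))
     (is_derive_scale 6^-1 (is_derive_scale 1 (is_derive_pow 5 dv)))))
   (is_derive_scale l (is_derive_mul du dv)).
apply: (is_derive_eq H).
exact: potential_algebra (equ x) (eqv x).
Qed.

Definition flux (i : 'I_3) (x : R3 R) : R :=
  A * pohozaev_field u i x + B * pohozaev_field v i x
  + coord i x * system_potential x.

Lemma divergence_flux x : divergence flux x =
  - (A * c1 * u x ^+ 2 + B * c2 * v x ^+ 2 - 2 * l * (u x * v x)).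
Proof.
have D i : partial i (flux i) x = A * partial i (pohozaev_field u i) x
    + B * partial i (pohozaev_field v i) x + (system_potential x + coord i x *
    (- A * laplacian u x * partial i u x - B * laplacian v x * partial i v x)).
  apply: partial_eq; apply: is_derive_add.
    by apply: is_derive_add; apply: is_derive_scale;
      apply: (Ck_derive (k := 0)); exact: Ck_pohozaev_field.
  apply: (is_derive_eq (is_derive_mul (is_derive_coord i i x) (is_derive_potential i x))).
  by rewrite eqxx mul1r.
have -> : divergence flux x = A * divergence (pohozaev_field u) x
    + B * divergence (pohozaev_field v) x + (3 * system_potential x
    - A * laplacian u x * radial u x - B * laplacian v x * radial v x).
  by rewrite -flux_sum; apply: eq_bigr => i _; exact: D.
rewrite !divergence_pohozaev_field// /system_potential.
exact: flux_algebra (equ x) (eqv x).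
Qed.

Lemma flux_bound i x : `|flux i x| <= (1 + \sum_(j < 3) `|coord j x|) *
  (`|A| * (2 * (grad_sqr u x + u x ^+ 2)) + `|B| * (2 * (grad_sqr v x + v x ^+ 2))
   + `|system_potential x|).
Proof.
rewrite mulrDr mulrDr (le_trans (ler_normD _ _))// lerD//.
  rewrite (le_trans (ler_normD _ _))// lerD// normrM mulrCA ler_wpM2l//;
    exact: pohozaev_field_bound.
rewrite normrM ler_wpM2r// (le_trans (coord_le_sum i x))// lerDr//.
Qed.

Lemma Ck_flux i : Ck 1 (flux i).
Proof.
apply: Ck_add; last by apply: Ck_mul; [exact: Ck_coord|exact: Ck_pred Ck_potential].
by apply: Ck_add; apply: Ck_scale; exact: Ck_pohozaev_field.
Qed.

Lemma pohozaev_nonexistence :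
  ~ (forall x, 0 < A * c1 * u x ^+ 2 + B * c2 * v x ^+ 2 - 2 * l * (u x * v x)).
Proof.
move=> Q0.
pose Q x := A * c1 * u x ^+ 2 + B * c2 * v x ^+ 2 - 2 * l * (u x * v x).
have iQ : mu3.-integrable setT (EFin \o Q).
  apply: integrable_sub; first by apply: integrable_add; exact: integrable_scale.
  apply: integrable_scale.
  exact: mul_integrable (Ck_continuous Cu) (Ck_continuous Cv) iu iv.
pose K x := `|A| * (2 * (grad_sqr u x + u x ^+ 2)) + `|B| * (2 * (grad_sqr v x + v x ^+ 2))
   + `|system_potential x|.
have iK : mu3.-integrable setT (EFin \o K).
  apply: integrable_add.
    by apply: integrable_add; do 2!apply: integrable_scale; exact: integrable_add.
  exact: integrable_norm potential_integrable.
have E : divergence flux = (fun x => -1 * Q x).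
  by apply/funext => x; rewrite divergence_flux mulN1r.
have := integral_divergence0 Ck_flux iK flux_bound.
rewrite E => /(_ (integrable_scale (-1) iQ)).
rewrite RintegralZl// => /eqP; rewrite mulf_eq0 oppr_eq0 oner_eq0/= => /eqP H.
by have := Rintegral_gt0 iQ Q0; rewrite H ltxx.
Qed.

End Nonexistence.

(** * Vanishing potentials *)

Section ZeroPotential.
Context {R : realType}.
Implicit Types v : R3 R -> R.

(** The indicator is kept because the bound will be multiplied by a function that is only known to
    be square-integrable. *)
Lemma partial2_cutoff_bound : exists2 M : R, 0 <= M & forall n i x,
  `|partial i (partial i (cutoff n)) x| <= M * (n.+1%:R ^+ 2)^-1 * \1_(box n.+1%:R) x.
Proof.
have s2 i : supported 1 (partial i (partial i (@cutoff0 R))).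
  by apply: supported_partial; apply: supported_partial; exact: cutoff0_supported.
have B i : exists M, forall x, `|partial i (partial i (@cutoff0 R)) x| <= M.
  apply: (@continuous_supported_bounded _ 1) => //.
  exact: Ck_continuous (Ck_partial i (Ck_partial i (cutoff0_Ck 2))).
pose M i := projT1 (cid (B i)).
have HM i x : `|partial i (partial i cutoff0) x| <= M i := projT2 (cid (B i)) x.
exists (\sum_(i < 3) `|M i|); first exact: sumr_ge0.
move=> n i x; have [bx|nx] := pselect (box n.+1%:R x); last first.
  have sp : supported n.+1%:R (partial i (partial i (@cutoff R n))).
    by apply: supported_partial; apply: supported_partial; exact: cutoff_supported.
  have -> : \1_(box n.+1%:R) x = 0 :> R by rewrite indicE memNset.
  by rewrite (supported_box sp nx) normr0 mulr0.
have -> : \1_(box n.+1%:R) x = 1 :> R by rewrite indicE mem_set.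
rewrite mulr1 partial2_cutoff normrM mulrC (ger0_norm (x := _^-1)); last first.
  by rewrite invr_ge0 exprn_ge0.
rewrite ler_wpM2r ?invr_ge0 ?exprn_ge0// (le_trans (HM i _))//.
by rewrite (bigD1 i)//= (le_trans (ler_norm _))// lerDl sumr_ge0.
Qed.

Lemma integral_cutoff_laplacian n v : Ck 2 v ->
  \int[mu3]_x (cutoff n x * laplacian v x) =
  \sum_(i < 3) \int[mu3]_x (v x * partial i (partial i (cutoff n)) x).
Proof.
move=> Cv; have sc := @cutoff_supported R n.
have Cc := @cutoff_Ck R n 1; have cc := Ck_continuous Cc.
transitivity (\int[mu3]_x (\sum_(i < 3) partial i (partial i v) x * cutoff n x)).
  by apply: eq_Rintegral => x _; rewrite mulrC /laplacian mulr_suml.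
rewrite Rintegral_sum3; last first.
  move=> i; apply: (supported_mul_integrable _ cc sc).
  exact: Ck_continuous (Ck_partial i (Ck_partial i Cv)).
apply: eq_bigr => i _.
rewrite (@integration_by_parts_supported _ n.+1%:R v _ i (Ck_pred Cv)
  (Ck_partial i (cutoff_Ck n 2))); last exact: supported_partial.
by rewrite (@integration_by_parts_supported _ n.+1%:R _ _ i (Ck_partial i Cv) Cc sc) opprK.
Qed.

Lemma Rintegral_box r : 0 <= r -> \int[mu3]_x (\1_(box r) x : R) = (2 * r) ^+ 3.
Proof.
move=> r0; rewrite /Rintegral integral_indic//; last exact: measurable_box.
by rewrite setIT mu3_box.
Qed.

Lemma cvg_invsqrt : (Num.sqrt (n.+1%:R : R))^-1 @[n --> \oo] --> (0 : R).
Proof.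
have -> : (fun n => (Num.sqrt (n.+1%:R : R))^-1) = (fun n => Num.sqrt (n.+1%:R^-1 : R)).
  by apply/funext => n; rewrite sqrtrV.
have := cvg_comp _ _ (@cvg_harmonic R) (@sqrt_continuous R 0).
by rewrite sqrtr0.
Qed.

(* With [s = sqrt N], the weight [v N^-2 1_box] is at most [v^2/s + 1_box/s^7],
   and the box of size [N] has volume [8 N^3 = 8 s^6]. *)
Lemma integral_partial2_cutoff_bound v : Ck 2 v -> (forall x, 0 < v x) ->
  mu3.-integrable setT (EFin \o (fun x => v x ^+ 2)) ->
  exists M : R, forall n i,
  `|\int[mu3]_x (v x * partial i (partial i (cutoff n)) x)| <= M * (Num.sqrt n.+1%:R)^-1.
Proof.
move=> Cv vp iv; have [M M0 HM] := partial2_cutoff_bound.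
exists (M * (\int[mu3]_x (v x ^+ 2) + 8)) => n i.
set s := Num.sqrt (n.+1%:R : R).
have s0 : 0 < s by rewrite sqrtr_gt0.
have sE : s ^+ 2 = n.+1%:R by rewrite sqr_sqrtr.
pose g x := M * (s^-1 * v x ^+ 2 + s^-1 ^+ 7 * \1_(box n.+1%:R) x).
have ib := @box_indic_integrable R n.+1%:R.
have ig : mu3.-integrable setT (EFin \o g).
  by apply: integrable_scale; apply: integrable_add; exact: integrable_scale.
have cv := Ck_continuous Cv.
have c2 : continuous (partial i (partial i (@cutoff R n))).
  exact: Ck_continuous (Ck_partial i (Ck_partial i (cutoff_Ck n 2))).
have bound x : `|v x * partial i (partial i (cutoff n)) x| <= g x.
  rewrite normrM (gtr0_norm (vp x)).
  apply: (le_trans (ler_wpM2l (ltW (vp x)) (HM n i x))).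
  rewrite -[in (_ ^+ 2)^-1]sE /g; have [bx|nx] := pselect (box n.+1%:R x); last first.
    have -> : \1_(box n.+1%:R) x = 0 :> R by rewrite indicE memNset.
    by rewrite !mulr0 addr0 !mulr_ge0 ?invr_ge0 ?sqr_ge0// ltW.
  have -> : \1_(box n.+1%:R) x = 1 :> R by rewrite indicE mem_set.
  rewrite !mulr1 mulrCA ler_wpM2l// -exprM -exprVn.
  have : 0 < s^-1 by rewrite invr_gt0.
  move: (s^-1) (v x) => t a t0.
  (* AM-GM for [a] and t^3, multiplied by [t], where [t] is 1/s. *)
  have : 0 <= t * ((a - t ^+ 3) ^+ 2 + a ^+ 2 + (t ^+ 3) ^+ 2).
    by rewrite mulr_ge0 ?(ltW t0)// !addr_ge0// sqr_ge0.
  have -> : t * ((a - t ^+ 3) ^+ 2 + a ^+ 2 + (t ^+ 3) ^+ 2) =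
    2 * ((t * a ^+ 2 + t ^+ 7) - a * t ^+ 4) by ring.
  by rewrite pmulr_rge0// subr_ge0.
have ivc : mu3.-integrable setT (EFin \o (fun x => v x * partial i (partial i (cutoff n)) x)).
  exact: dominated_integrable (continuous_measurable_R3 (continuous_mul cv c2)) ig bound.
apply: (le_trans (le_normr_Rintegral measurableT ivc)).
apply: (@le_trans _ _ (\int[mu3]_x g x)).
  apply: le_Rintegral => //; exact: integrable_norm ivc.
rewrite /g RintegralZl//; last by apply: integrable_add; exact: integrable_scale.
rewrite RintegralD//; [|exact: integrable_scale|exact: integrable_scale].
rewrite RintegralZl// RintegralZl// Rintegral_box// -sE.
rewrite -mulrA; apply: ler_wpM2l => //.
move: (\int[mu3]_x (v x ^+ 2)) => I.
rewrite le_eqVlt; apply/orP; left; apply/eqP.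
have sn : s != 0 by rewrite gt_eqF.
by field.
Qed.

(** Both derivatives of the Laplacian are moved onto the cutoff, where they cost O(1/n^2). Fatou
    takes the limit, since integrability of v^5 is not known beforehand. *)
Lemma no_positive_L2_solution (B : R) v : Ck 2 v -> (forall x, 0 < v x) ->
  (forall x, B * (- laplacian v x) = v x ^+ 5) ->
  mu3.-integrable setT (EFin \o (fun x => v x ^+ 2)) -> False.
Proof.
move=> Cv vp eqv iv.
have [M HM] := integral_partial2_cutoff_bound Cv vp iv.
have cv := Ck_continuous Cv.
have c5 : continuous (fun x => v x ^+ 5) := Ck_continuous (Ck_pow 5 Cv).
have cc n : continuous (@cutoff R n) := Ck_continuous (cutoff_Ck n 0).
have cl : continuous (laplacian v).
  by apply: continuous_sum3 => i; exact: Ck_continuous (Ck_partial i (Ck_partial i Cv)).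
have i5 n : mu3.-integrable setT (EFin \o (fun x => v x ^+ 5 * cutoff n x)).
  exact: supported_mul_integrable c5 (cc n) (@cutoff_supported _ n).
have il n : mu3.-integrable setT (EFin \o (fun x => cutoff n x * laplacian v x)).
  have := supported_mul_integrable cl (cc n) (@cutoff_supported _ n).
  by apply: eq_integrable => // x _; rewrite /= mulrC.
have E n : \int[mu3]_x (v x ^+ 5 * cutoff n x) =
    - B * \sum_(i < 3) \int[mu3]_x (v x * partial i (partial i (cutoff n)) x).
  rewrite -integral_cutoff_laplacian// -RintegralZl//.
  by apply: eq_Rintegral => x _; rewrite -eqv; ring.
have C0 : \int[mu3]_x (v x ^+ 5 * cutoff n x) @[n --> \oo] --> (0 : R).
  apply/cvgr0Pnorm_le => e e0.
  have H : `|B| * (3 * M) * (Num.sqrt n.+1%:R)^-1 @[n --> \oo] --> (`|B| * (3 * M) * 0 : R).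
    by apply: cvgM; [exact: cvg_cst|exact: cvg_invsqrt].
  rewrite mulr0 in H; move/cvgr0Pnorm_le/(_ _ e0) : H.
  apply: filterS => n h; apply: le_trans (le_trans (ler_norm _) h).
  rewrite E normrM normrN -mulrA ler_wpM2l//.
  rewrite (le_trans (ler_norm_sum _ _ _))//.
  apply: (@le_trans _ _ (\sum_(i < 3) M * (Num.sqrt n.+1%:R)^-1)).
    by apply: ler_sum => i _; exact: HM.
  by rewrite sumr_const card_ord -[X in X <= _]mulr_natl mulrA.
have c0 := @cutoff0_gt0 R.
have [ifin] := @Rfatou _ (fun n x => v x ^+ 5 * cutoff n x)
  (fun x => v x ^+ 5 * cutoff0 0) 0
  (fun n => continuous_measurable_R3 (continuous_mul c5 (cc n)))
  (continuous_measurable_R3 (continuous_mul c5 (fun x => cvg_cst _)))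
  (fun n x => mulr_ge0 (exprn_ge0 5 (ltW (vp x))) (proj1 (andP (cutoff_itv n x))))
  (fun x => cvgM (cvg_cst _) (@cvg_cutoff _ x)) i5 C0.
rewrite leNgt => /negP; apply; apply: Rintegral_gt0 => // x.
by rewrite mulr_gt0// exprn_gt0.
Qed.

End ZeroPotential.

(** * Positivity of the quadratic form and conclusion *)

Section Reduction.
Context {R : realType}.

Lemma sobolev_grad_sqr_integrable (u : R3 R -> R) : Ck 2 u -> sobolev_H1 u ->
  mu3.-integrable setT (EFin \o grad_sqr u).
Proof.
move=> Cu [_ H]; apply: integrable_sum3 => i.
by have [g wg] := H i; exact: weak_partial_sqr_integrable (Ck_pred Cu) wg.
Qed.

Lemma sqnormE_ge0 (V w : R3 R -> R) : (forall x, 0 <= V x) -> 0 <= sqnormE V w.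
Proof.
move=> V0; rewrite /sqnormE addr_ge0//; apply: Rintegral_ge0 => x _.
  by apply: sumr_ge0 => i _; exact: sqr_ge0.
by rewrite mulr_ge0// sqr_ge0.
Qed.

(** With X = sqrt c1 and Y = sqrt c2 the form equals (A - delta)(X a)^2 + (B - delta)(Y b)^2 + delta
    (X a - Y b)^2 + 2 (delta X Y - l) a b. The first two terms give strictness as soon as X or Y is
    nonzero. *)
Lemma coupled_form_gt0 (A B c1 c2 l delta a b : R) :
  0 < delta -> delta < A -> delta < B -> 0 <= c1 -> 0 <= c2 ->
  `|l| <= delta * Num.sqrt (c1 * c2) -> 0 < a -> 0 < b ->
  (c1 != 0) || (c2 != 0) ->
  0 < A * c1 * a ^+ 2 + B * c2 * b ^+ 2 - 2 * l * (a * b).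
Proof.
move=> d0 dA dB c10 c20 hl a0 b0 c12.
rewrite sqrtrM// in hl.
have X0 := sqrtr_ge0 c1; have Y0 := sqrtr_ge0 c2.
have XE : c1 = Num.sqrt c1 ^+ 2 by rewrite sqr_sqrtr.
have YE : c2 = Num.sqrt c2 ^+ 2 by rewrite sqr_sqrtr.
have XY : (0 < Num.sqrt c1) || (0 < Num.sqrt c2).
  by rewrite !sqrtr_gt0 !lt_neqAle c10 c20 !andbT ![0 == _]eq_sym.
rewrite XE YE {XE YE c12 c10 c20}.
move: (Num.sqrt c1) (Num.sqrt c2) hl X0 Y0 XY => X Y hl X0 Y0 XY.
have h1 : l * (a * b) <= delta * (X * Y) * (a * b).
  by rewrite ler_wpM2r ?mulr_ge0 ?(ltW a0) ?(ltW b0)// (le_trans (ler_norm l)).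
have h2 : 0 <= delta * (X * a - Y * b) ^+ 2 by rewrite mulr_ge0 ?sqr_ge0// ltW.
have h3 : 0 < (A - delta) * (X * a) ^+ 2 + (B - delta) * (Y * b) ^+ 2.
  have hA : 0 < A - delta by rewrite subr_gt0.
  have hB : 0 < B - delta by rewrite subr_gt0.
  case/orP: XY => Z.
    apply: ltr_wpDr; first by rewrite mulr_ge0 ?sqr_ge0// ltW.
    by rewrite mulr_gt0// exprn_gt0// mulr_gt0.
  apply: ltr_wpDl; first by rewrite mulr_ge0 ?sqr_ge0// ltW.
  by rewrite mulr_gt0// exprn_gt0// mulr_gt0.
have -> : A * X ^+ 2 * a ^+ 2 + B * Y ^+ 2 * b ^+ 2 - 2 * l * (a * b) =
  ((A - delta) * (X * a) ^+ 2 + (B - delta) * (Y * b) ^+ 2)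
  + delta * (X * a - Y * b) ^+ 2 + 2 * (delta * (X * Y) * (a * b) - l * (a * b)) by ring.
have h4 : 0 <= 2 * (delta * (X * Y) * (a * b) - l * (a * b)).
  by rewrite mulr_ge0// subr_ge0.
by rewrite ltr_wpDr// ltr_wpDr.
Qed.

End Reduction.

Theorem theorem1p3 (R : realType) (a1 a2 : R) (alpha beta : R -> R)
    (V1 V2 lam : R3 R -> R) (C : R)
    (ha1 : 0 < a1) (ha2 : 0 < a2)
    (alphaC2 : C2_Rplus alpha) (betaC2 : C2_Rplus beta)
    (hM1 : cond_M1 alpha beta) (hM2 : cond_M2 alpha beta)
    (hM3 : cond_M3 alpha beta) (hM4 : cond_M4 alpha beta)
    (hV1 : cond_V1 V1 V2 lam) (hV2 : cond_V2 V1 V2)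
    (hV3 : cond_V3 a1 a2 V1 V2 lam)
    (hC : 0 < C) (hV4 : cond_V4 C V1 V2) (hV5 : cond_V5 C lam)
    (mu : R) (hmu : 0 <= mu) :
  ~ exists u v : R3 R -> R,
      positive_classical_solution a1 a2 alpha beta V1 V2 lam mu u v.
Proof.
move=> [u [v [[[Hu _] [Hv _]] [Cu Cv] pos eq1 eq2]]].
have [[_ pV1] [_ pV2] [_ plam]] := hV1.
have [[V10 _] [V20 _]] := hV2.
have [delta [d0 dmin hl]] := hV3.
have [[CV1 gV1] [CV2 gV2]] := hV4.
have [Clam glam] := hV5.
have E1 x : V1 x = V1 0.
  apply: (periodic_cst (oner_neq0 R)) => // y; rewrite mul1r.
  by have /andP[] := gV1 y.
have E2 x : V2 x = V2 0.
  apply: (periodic_cst (oner_neq0 R)) => // y; rewrite mul1r.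
  by have /andP[] := gV2 y.
have El x : lam x = lam 0.
  have m1 : (-1 : R) != 0 by rewrite oppr_eq0 oner_neq0.
  apply: (periodic_cst m1) => // y; rewrite mulN1r oppr_ge0.
  by have [] := glam y.
move: dmin; rewrite lt_min => /andP[da1 da2].
have [da _] := derive_Rplus_ge0 alphaC2 betaC2 hM3 (sqnormE_ge0 u V10).
have [_ db] := derive_Rplus_ge0 alphaC2 betaC2 hM3 (sqnormE_ge0 v V20).
set A := a1 + _ in eq1; set B := a2 + _ in eq2.
have dA : delta < A by rewrite /A ltr_wpDr.
have dB : delta < B by rewrite /B ltr_wpDr.
have up x : 0 < u x by have [] := pos x.
have vp x : 0 < v x by have [] := pos x.
have equ x : A * (- laplacian u x + V1 0 * u x) = mu * u x ^+ 5 + lam 0 * v x.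
  by have := eq1 x; rewrite E1 El gtr0_norm// -mulrA -exprSr.
have eqv x : B * (- laplacian v x + V2 0 * v x) = 1 * v x ^+ 5 + lam 0 * u x.
  by have := eq2 x; rewrite E2 El gtr0_norm// -exprSr mul1r.
have iu := L2_sqr_integrable (proj1 Hu); have iv := L2_sqr_integrable (proj1 Hv).
have igu := sobolev_grad_sqr_integrable Cu Hu.
have igv := sobolev_grad_sqr_integrable Cv Hv.
have [c12|] := boolP ((V1 0 != 0) || (V2 0 != 0)).
  apply: (pohozaev_nonexistence Cu Cv up vp hmu equ eqv iu iv igu igv) => x.
  exact: (coupled_form_gt0 d0 dA dB (V10 0) (V20 0) (hl 0)).
rewrite negb_or !negbK => /andP[/eqP c10 /eqP c20].
have l0 : lam 0 = 0.
  by apply/eqP; rewrite -normr_le0 (le_trans (hl 0))// c10 mul0r sqrtr0 mulr0.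
(* The equation of [v] is the one to use: its nonlinearity has coefficient 1, whereas [mu] may be
   0. *)
apply: (@no_positive_L2_solution _ B v Cv vp _ iv) => x.
by have := eqv x; rewrite c20 l0 !mul0r !addr0 mul1r.
Qed.
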